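(* Let $k$ be an algebraically closed field of characteristic zero and let $G$ be a finite group. The Drinfeld centre $\mathcal{Z}(G)$ has a dualising braided tensor autoequivalence if and only if the group $G$ has a double class-inverting automorphism.
   Context: A $G$-action on a finite-dimensional $G$-graded $k$-vector space $V=\bigoplus_{g\in G}V_g$ is compatible with the grading if $f(V_g)=V_{fgf^{-1}}$ for all $f,g\in G$. The Drinfeld centre $\mathcal{Z}(G)$ is the category of finite-dimensional $G$-graded $k$-vector spaces with compatible ($k$-linear) $G$-actions; morphisms are $k$-linear maps preserving both grading and action. The tensor product $V\otimes U$ is the tensor product of graded vector spaces, $(V\otimes U)_g=\bigoplus_{ab=g}V_a\otimes U_b$, with the diagonal $G$-action and the trivial associativity constraint. The braiding $c_{V,U}:V\otimes U\to U\otimes V$ is $c_{V,U}(v\otimes u)=f(u)\otimes v$ for $v\in V_f$, $u\in U$. The dual object of $V$ is $V^*=\mathrm{Hom}_k(V,k)$ with grading $(V^* )_g=(V_{g^{-1}})^*$ and action $(f(l))(v)=l(f^{-1}(v))$ for $f\in G$, $l\in V^*$, $v\in V$. A braided tensor autoequivalence is a $k$-linear monoidal autoequivalence compatible with the braiding. A tensor autoequivalence $F:\mathcal{C}\to\mathcal{C}$ is called dualising if $F(X)\simeq X^*$ for every object $X\in\mathcal{C}$ (no naturality of these isomorphisms is required). A group automorphism $\phi:G\to G$ is called double class-inverting if for any commuting pair $f,g$ of elements of $G$ there is $h\in G$ such that $\phi(f)=hf^{-1}h^{-1}$ and $\phi(g)=hg^{-1}h^{-1}$. *)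

(* Defs.v *)
From HB Require Import structures.
From mathcomp Require Import all_boot all_order all_algebra all_fingroup.

Set Implicit Arguments.
Unset Strict Implicit.
Unset Printing Implicit Defensive.

Import GRing.Theory.
Local Open Scope ring_scope.

Declare Scope cat_scope.
Delimit Scope cat_scope with cat.
Reserved Notation "g \oc f" (at level 50, left associativity).
Reserved Notation "v *t u" (at level 40, left associativity).

Record linCat (k : nzRingType) := LinCat {
  obj : Type;
  hom : obj -> obj -> lmodType k;
  idm : forall X, hom X X;
  comp : forall X Y Z, hom Y Z -> hom X Y -> hom X Z;
  comp_linear_l : forall X Y Z (f : hom X Y),
    linear (fun g : hom Y Z => comp g f);
  comp_linear_r : forall X Y Z (g : hom Y Z),
    linear (fun f : hom X Y => comp g f);
  compmA : forall X Y Z W (h : hom Z W) (g : hom Y Z) (f : hom X Y),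
    comp h (comp g f) = comp (comp h g) f;
  comp1m : forall X Y (f : hom X Y), comp (idm Y) f = f;
  compm1 : forall X Y (f : hom X Y), comp f (idm X) = f
}.
Arguments hom {k l}.
Arguments idm {k l}.
Arguments comp {k l X Y Z}.

Notation "g \oc f" := (comp g f) : cat_scope.
Local Open Scope cat_scope.

Definition is_iso (k : nzRingType) (C : linCat k) (X Y : obj C)
    (f : hom X Y) : Prop :=
  exists g : hom Y X, g \oc f = idm X /\ f \oc g = idm Y.

Definition isomorphic (k : nzRingType) (C : linCat k) (X Y : obj C) : Prop :=
  exists f : hom X Y, is_iso f.

Record monCat (k : nzRingType) := MonCat {
  moncat_lin :> linCat k;
  munit : obj moncat_lin;
  tenso : obj moncat_lin -> obj moncat_lin -> obj moncat_lin;
  tensm : forall X X' Y Y' : obj moncat_lin,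
    hom X X' -> hom Y Y' -> hom (tenso X Y) (tenso X' Y');
  tensm_linear_l : forall X X' Y Y' (g : hom Y Y'),
    linear (fun f : hom X X' => tensm f g);
  tensm_linear_r : forall X X' Y Y' (f : hom X X'),
    linear (fun g : hom Y Y' => tensm f g);
  tensm1 : forall X Y, tensm (idm X) (idm Y) = idm (tenso X Y);
  tensm_comp : forall X X' X'' Y Y' Y''
      (f' : hom X' X'') (f : hom X X') (g' : hom Y' Y'') (g : hom Y Y'),
    tensm (f' \oc f) (g' \oc g) = tensm f' g' \oc tensm f g;
  massoc : forall X Y Z, hom (tenso (tenso X Y) Z) (tenso X (tenso Y Z));
  massocV : forall X Y Z, hom (tenso X (tenso Y Z)) (tenso (tenso X Y) Z);
  massocK : forall X Y Z, massocV X Y Z \oc massoc X Y Z = idm _;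
  massocVK : forall X Y Z, massoc X Y Z \oc massocV X Y Z = idm _;
  massoc_nat : forall X X' Y Y' Z Z'
      (f : hom X X') (g : hom Y Y') (h : hom Z Z'),
    massoc X' Y' Z' \oc tensm (tensm f g) h
    = tensm f (tensm g h) \oc massoc X Y Z;
  mlunit : forall X, hom (tenso munit X) X;
  mlunit_iso : forall X, is_iso (mlunit X);
  mlunit_nat : forall X Y (f : hom X Y),
    mlunit Y \oc tensm (idm munit) f = f \oc mlunit X;
  mrunit : forall X, hom (tenso X munit) X;
  mrunit_iso : forall X, is_iso (mrunit X);
  mrunit_nat : forall X Y (f : hom X Y),
    mrunit Y \oc tensm f (idm munit) = f \oc mrunit X;
  mtriangle : forall X Y,
    tensm (idm X) (mlunit Y) \oc massoc X munit Y = tensm (mrunit X) (idm Y);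
  mpentagon : forall X Y Z W,
    massoc X Y (tenso Z W) \oc massoc (tenso X Y) Z W
    = tensm (idm X) (massoc Y Z W) \oc massoc X (tenso Y Z) W
      \oc tensm (massoc X Y Z) (idm W)
}.
Arguments munit {k}.
Arguments tenso {k m}.
Arguments tensm {k m X X' Y Y'}.
Arguments massoc {k m}.
Arguments massocV {k m}.
Arguments mlunit {k m}.
Arguments mrunit {k m}.

Record braidedCat (k : nzRingType) := BraidedCat {
  braidedcat_mon :> monCat k;
  braid : forall X Y : obj braidedcat_mon, hom (tenso X Y) (tenso Y X);
  braid_iso : forall X Y, is_iso (braid X Y);
  braid_nat : forall X X' Y Y' (f : hom X X') (g : hom Y Y'),
    braid X' Y' \oc tensm f g = tensm g f \oc braid X Y;
  braid_hexagon_r : forall X Y Z,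
    massoc Y Z X \oc braid X (tenso Y Z) \oc massoc X Y Z
    = tensm (idm Y) (braid X Z) \oc massoc Y X Z \oc tensm (braid X Y) (idm Z);
  braid_hexagon_l : forall X Y Z,
    massocV Z X Y \oc braid (tenso X Y) Z \oc massocV X Y Z
    = tensm (braid X Z) (idm Y) \oc massocV X Z Y \oc tensm (idm X) (braid Y Z)
}.
Arguments braid {k b}.

Record linFunctor (k : nzRingType) (C D : linCat k) := LinFunctor {
  fobj :> obj C -> obj D;
  fmor : forall X Y, hom X Y -> hom (fobj X) (fobj Y);
  fmor_linear : forall X Y, linear (@fmor X Y);
  fmor1 : forall X, fmor (idm X) = idm (fobj X);
  fmor_comp : forall X Y Z (g : hom Y Z) (f : hom X Y),
    fmor (g \oc f) = fmor g \oc fmor f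
}.
Arguments fmor {k C D} l {X Y}.

Section FunctorOps.
Variables (k : nzRingType) (C D E : linCat k).

Definition id_functor : linFunctor C C.
Proof. by apply: (@LinFunctor k C C id (fun X Y => id)). Defined.

Definition comp_functor (G : linFunctor D E) (F : linFunctor C D) :
  linFunctor C E.
Proof.
apply: (@LinFunctor k C E (fun X => G (F X))
  (fun X Y f => fmor G (fmor F f))) => [X Y a f g|X|X Y Z g f].
- by rewrite !fmor_linear.
- by rewrite !fmor1.
- by rewrite !fmor_comp.
Defined.

Definition naturally_isomorphic (F G : linFunctor C D) : Prop :=
  exists eta : forall X, hom (F X) (G X),
    (forall X, is_iso (eta X)) /\
    (forall X Y (f : hom X Y), eta Y \oc fmor F f = fmor G f \oc eta X).

End FunctorOps.

Definition is_equivalence (k : nzRingType) (C D : linCat k)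
    (F : linFunctor C D) : Prop :=
  exists G : linFunctor D C,
    naturally_isomorphic (comp_functor G F) (id_functor C) /\
    naturally_isomorphic (comp_functor F G) (id_functor D).

Record monFunctor (k : nzRingType) (C D : monCat k) := MonFunctor {
  monfunctor_lin :> linFunctor C D;
  fmon : forall X Y : obj C,
    hom (tenso (monfunctor_lin X) (monfunctor_lin Y))
        (monfunctor_lin (tenso X Y));
  fmon0 : hom (munit D) (monfunctor_lin (munit C));
  fmon_iso : forall X Y, is_iso (fmon X Y);
  fmon0_iso : is_iso fmon0;
  fmon_nat : forall X X' Y Y' (f : hom X X') (g : hom Y Y'),
    fmon X' Y' \oc tensm (fmor monfunctor_lin f) (fmor monfunctor_lin g)
    = fmor monfunctor_lin (tensm f g) \oc fmon X Y;
  fmon_assoc : forall X Y Z,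
    fmor monfunctor_lin (massoc X Y Z) \oc fmon (tenso X Y) Z
      \oc tensm (fmon X Y) (idm (monfunctor_lin Z))
    = fmon X (tenso Y Z) \oc tensm (idm (monfunctor_lin X)) (fmon Y Z)
      \oc massoc (monfunctor_lin X) (monfunctor_lin Y) (monfunctor_lin Z);
  fmon_lunit : forall X,
    fmor monfunctor_lin (mlunit X) \oc fmon (munit C) X
      \oc tensm fmon0 (idm (monfunctor_lin X))
    = mlunit (monfunctor_lin X);
  fmon_runit : forall X,
    fmor monfunctor_lin (mrunit X) \oc fmon X (munit C)
      \oc tensm (idm (monfunctor_lin X)) fmon0
    = mrunit (monfunctor_lin X)
}.
Arguments fmon {k C D}.
Arguments fmon0 {k C D}.

Record braidedFunctor (k : nzRingType) (C D : braidedCat k) := BraidedFunctor {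
  braidedfunctor_mon :> monFunctor C D;
  fmon_braid : forall X Y : obj C,
    fmor braidedfunctor_mon (braid X Y) \oc fmon braidedfunctor_mon X Y
    = fmon braidedfunctor_mon Y X
      \oc braid (braidedfunctor_mon X) (braidedfunctor_mon Y)
}.

(* [V] (x) [U] is modelled by coordinate matrices with respect to the bases
   [vbasis {:V}] and [vbasis {:U}]; [tlift] is its universal property. *)
Section Tensor.
Variable k : fieldType.

Definition tensv (V U : vectType k) : vectType k :=
  'M[k]_(\dim {:V}, \dim {:U}).

Definition tens (V U : vectType k) (v : V) (u : U) : tensv V U :=
  \matrix_(i, j) (coord (vbasis {:V}) i v * coord (vbasis {:U}) j u).

End Tensor.
Notation "v *t u" := (tens v u) : ring_scope.

Section TensorTheory.
Variable k : fieldType.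
Implicit Types V U W T : vectType k.

Definition tlift_fun V U W (b : V -> U -> W) (m : tensv V U) : W :=
  \sum_i \sum_j m i j *: b (vbasis {:V})`_i (vbasis {:U})`_j.

Fact tlift_fun_is_linear V U W (b : V -> U -> W) : linear (tlift_fun b).
Proof.
move=> a x y; rewrite /tlift_fun scaler_sumr -big_split; apply: eq_bigr => i _.
rewrite scaler_sumr -big_split; apply: eq_bigr => j _ /=.
by rewrite !mxE scalerDl scalerA.
Qed.

HB.instance Definition _ V U W (b : V -> U -> W) :=
  GRing.isLinear.Build k (tensv V U) W _ (tlift_fun b)
    (tlift_fun_is_linear b).

Definition tlift V U W (b : V -> U -> W) : 'Hom(tensv V U, W) :=
  linfun (tlift_fun b).

Lemma tens_linear_l V U (u : U) : linear (fun v : V => v *t u).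
Proof.
move=> a v w; apply/matrixP=> i j.
by rewrite !mxE linearP mulrDl -mulrA.
Qed.

Lemma tens_linear_r V U (v : V) : linear (fun u : U => v *t u).
Proof.
move=> a x y; apply/matrixP=> i j.
by rewrite !mxE linearP mulrDr mulrCA.
Qed.

HB.instance Definition _ V U (v : V) :=
  GRing.isLinear.Build k U (tensv V U) _ (tens v) (tens_linear_r v).

Definition tensC V U (u : U) (v : V) : tensv V U := v *t u.
HB.instance Definition _ V U (u : U) :=
  GRing.isLinear.Build k V (tensv V U) _ (@tensC V U u) (tens_linear_l u).

Definition ltens V U (v : V) : 'Hom(U, tensv V U) := linfun (tens v).
Definition rtens V U (u : U) : 'Hom(V, tensv V U) := linfun (@tensC V U u).

Lemma ltensE V U (v : V) (u : U) : ltens U v u = v *t u.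
Proof. exact: lfunE. Qed.

Lemma rtensE V U (v : V) (u : U) : rtens V u v = v *t u.
Proof. exact: lfunE. Qed.

Lemma tliftE V U W (b : V -> U -> W) :
  (forall u, linear (b^~ u)) -> (forall v, linear (b v)) ->
  forall v u, tlift b (v *t u) = b v u.
Proof.
move=> bl br v u; rewrite lfunE /= /tlift_fun.
have sum_lin (A B : vectType k) (h : A -> B) : linear h ->
    forall n (c : 'I_n -> k) (x : 'I_n -> A),
    h (\sum_i c i *: x i) = \sum_i c i *: h (x i).
  move=> hl n c x; pose hL : {linear A -> B} :=
    HB.pack h (GRing.isLinear.Build k A B _ h hl).
  change (hL (\sum_i c i *: x i) = \sum_i c i *: hL (x i)).
  by rewrite linear_sum; apply: eq_bigr => i _; rewrite linearZ.
rewrite [in RHS](coord_vbasis (memvf v)) (sum_lin _ _ (b^~ u)) //.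
apply: eq_bigr => i _.
rewrite [in RHS](coord_vbasis (memvf u)) (sum_lin _ _ (b _)) //.
rewrite scaler_sumr; apply: eq_bigr => j _.
by rewrite !mxE scalerA.
Qed.

Lemma tlift_lin V U W (b b1 b2 : V -> U -> W) (a : k) (m : tensv V U) :
  (forall v u, b v u = a *: b1 v u + b2 v u) ->
  tlift b m = a *: tlift b1 m + tlift b2 m.
Proof.
move=> bE; rewrite !lfunE /= /tlift_fun scaler_sumr -big_split.
apply: eq_bigr => i _; rewrite scaler_sumr -big_split; apply: eq_bigr => j _ /=.
by rewrite bE scalerDr !scalerA mulrC.
Qed.

Lemma tens_span V U (m : tensv V U) :
  m = \sum_i \sum_j m i j *: ((vbasis {:V})`_i *t (vbasis {:U})`_j).
Proof.
apply/matrixP => i j; rewrite summxE (bigD1 i) //= summxE (bigD1 j) //=.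
have cV := coord_free _ _ (basis_free (vbasisP {:V})).
have cU := coord_free _ _ (basis_free (vbasisP {:U})).
rewrite !mxE cV cU !eqxx !mulr1 big1 ?addr0 => [|j' /negPf nj]; last first.
  by rewrite !mxE cU nj !mulr0.
rewrite big1 ?addr0 // => i' /negPf ni.
by rewrite summxE big1 // => j' _; rewrite !mxE cV ni mul0r mulr0.
Qed.

Lemma tens_ext V U W (f g : 'Hom(tensv V U, W)) :
  (forall v u, f (v *t u) = g (v *t u)) -> f = g.
Proof.
move=> fg; apply/lfunP => m; rewrite (tens_span m) !linear_sum /=.
apply: eq_bigr => i _; rewrite !linear_sum; apply: eq_bigr => j _ /=.
by rewrite 2!linearZ /= fg.
Qed.

Lemma tens0l V U (u : U) : (0 : V) *t u = 0.
Proof. by apply/matrixP=> i j; rewrite !mxE linear0 mul0r. Qed.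

Lemma tens0r V U (v : V) : v *t (0 : U) = 0.
Proof. by apply/matrixP=> i j; rewrite !mxE linear0 mulr0. Qed.

Lemma tensZl V U (a : k) (v : V) (u : U) : (a *: v) *t u = a *: (v *t u).
Proof. by apply/matrixP=> i j; rewrite !mxE linearZ mulrA. Qed.

Lemma tensZr V U (a : k) (v : V) (u : U) : v *t (a *: u) = a *: (v *t u).
Proof. by apply/matrixP=> i j; rewrite !mxE linearZ mulrCA. Qed.

Lemma tens_suml V U I (r : seq I) (P : pred I) (F : I -> V) (u : U) :
  (\sum_(i <- r | P i) F i) *t u = \sum_(i <- r | P i) F i *t u.
Proof.
apply: (big_morph (fun v => v *t u)) => [x y|]; last exact: tens0l.
by have := tens_linear_l u 1 x y; rewrite !scale1r.
Qed.

Lemma tens_sumr V U I (r : seq I) (P : pred I) (F : I -> U) (v : V) :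
  v *t (\sum_(i <- r | P i) F i) = \sum_(i <- r | P i) v *t F i.
Proof.
apply: (big_morph (fun u => v *t u)) => [x y|]; last exact: tens0r.
by have := tens_linear_r v 1 x y; rewrite !scale1r.
Qed.

Definition tmap V V' U U' (f : 'Hom(V, V')) (g : 'Hom(U, U')) :
    'Hom(tensv V U, tensv V' U') :=
  tlift (fun v u => f v *t g u).

Lemma tmapE V V' U U' (f : 'Hom(V, V')) (g : 'Hom(U, U')) v u :
  tmap f g (v *t u) = f v *t g u.
Proof.
rewrite tliftE // => [x|x] a y z; rewrite linearP.
  exact: tens_linear_l.
exact: tens_linear_r.
Qed.

Definition tassoc V U W : 'Hom(tensv (tensv V U) W, tensv V (tensv U W)) :=
  tlift (fun m w => tlift (fun v u => v *t (u *t w)) m).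

Definition tassocV V U W : 'Hom(tensv V (tensv U W), tensv (tensv V U) W) :=
  tlift (fun v m => tlift (fun u w => (v *t u) *t w) m).

Lemma tassocE V U W (v : V) (u : U) (w : W) :
  tassoc V U W ((v *t u) *t w) = v *t (u *t w).
Proof.
have E w' (v' : V) (u' : U) :
    tlift (fun v u => v *t (u *t w')) (v' *t u') = v' *t (u' *t w').
  rewrite tliftE // => [x|x] a y z; first exact: tens_linear_l.
  by rewrite tens_linear_l tens_linear_r.
rewrite tliftE ?E // => [x|x] a y z; first by rewrite linearP.
by apply: tlift_lin => v' u'; rewrite !tens_linear_r.
Qed.

Lemma tassocVE V U W (v : V) (u : U) (w : W) :
  tassocV V U W (v *t (u *t w)) = (v *t u) *t w.
Proof.
have E v' (u' : U) (w' : W) :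
    tlift (fun u w => (v' *t u) *t w) (u' *t w') = (v' *t u') *t w'.
  rewrite tliftE // => [x|x] a y z; last exact: tens_linear_r.
  by rewrite tens_linear_r tens_linear_l.
rewrite tliftE ?E // => [x|x] a y z; last by rewrite linearP.
by apply: tlift_lin => u' w'; rewrite !tens_linear_l.
Qed.

Definition tlunit V : 'Hom(tensv k^o V, V) := tlift (fun (a : k^o) v => a *: v).
Definition trunit V : 'Hom(tensv V k^o, V) := tlift (fun v (a : k^o) => a *: v).

Lemma tlunitE V (a : k^o) (v : V) : tlunit V (a *t v) = (a : k) *: v.
Proof.
rewrite tliftE // => [x|x] b y z; first by rewrite scalerDl scalerA.
by rewrite scalerDr !scalerA mulrC.
Qed.

Lemma trunitE V (v : V) (a : k^o) : trunit V (v *t a) = (a : k) *: v.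
Proof.
rewrite tliftE // => [x|x] b y z; last by rewrite scalerDl scalerA.
by rewrite scalerDr !scalerA mulrC.
Qed.

Lemma tens_ext3l V U W T (f g : 'Hom(tensv (tensv V U) W, T)) :
  (forall v u w, f ((v *t u) *t w) = g ((v *t u) *t w)) -> f = g.
Proof.
move=> fg; apply: tens_ext => m w; rewrite [m]tens_span.
rewrite !tens_suml !linear_sum; apply: eq_bigr => i _ /=.
rewrite !tens_suml !linear_sum; apply: eq_bigr => j _ /=.
by rewrite tensZl 2!linearZ /= fg.
Qed.

Lemma tens_ext3r V U W T (f g : 'Hom(tensv V (tensv U W), T)) :
  (forall v u w, f (v *t (u *t w)) = g (v *t (u *t w))) -> f = g.
Proof.
move=> fg; apply: tens_ext => v m; rewrite [m]tens_span.
rewrite !tens_sumr !linear_sum; apply: eq_bigr => i _ /=.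
rewrite !tens_sumr !linear_sum; apply: eq_bigr => j _ /=.
by rewrite tensZr 2!linearZ /= fg.
Qed.

Lemma tpentagon V U W T :
  (tassoc V U (tensv W T) \o tassoc (tensv V U) W T
   = tmap \1 (tassoc U W T) \o tassoc V (tensv U W) T
     \o tmap (tassoc V U W) \1)%VF.
Proof.
apply: tens_ext => m t.
have E (f : 'Hom(tensv (tensv (tensv V U) W) T, _)) x :
    (f \o rtens _ t)%VF x = f (x *t t).
  by rewrite comp_lfunE rtensE.
rewrite -!E; move: m; apply/lfunP; apply: tens_ext3l => v u w.
by rewrite !E !comp_lfunE !tmapE !tassocE tmapE id_lfunE tassocE id_lfunE.
Qed.

(* The image of A (x) B in V (x) U. *)
Definition tens_sub V U (A : {vspace V}) (B : {vspace U}) :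
    {vspace tensv V U} :=
  <<[seq a *t b | a <- vbasis A, b <- vbasis B]>>%VS.

Lemma mem_tens_sub V U (A : {vspace V}) (B : {vspace U}) a b :
  a \in A -> b \in B -> a *t b \in tens_sub A B.
Proof.
move=> aA bB; rewrite (coord_vbasis aA) (coord_vbasis bB).
rewrite tens_suml rpred_sum // => i _; rewrite tens_sumr rpred_sum // => j _.
rewrite tensZl tensZr !rpredZ //.
by apply: memv_span; apply: allpairs_f; apply: mem_nth; rewrite size_tuple.
Qed.

Lemma limg_tens_sub V U W (A : {vspace V}) (B : {vspace U}) (C : {vspace W})
    (f : 'Hom(tensv V U, W)) :
  (forall a b, a \in A -> b \in B -> f (a *t b) \in C) ->
  (f @: tens_sub A B <= C)%VS.
Proof.
move=> fAB; rewrite limg_span; apply/span_subvP=> _ /mapP[m mAB ->].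
have /allpairsP[p [/vbasis_mem pA /vbasis_mem pB ->]] := mAB.
exact: fAB.
Qed.

End TensorTheory.

Section Centre.
Variables (k : fieldType) (gT : finGroupType).

(* Naming the predicate keeps [directv] from looking inside [gr g]. *)
Definition direct_family (V : vectType k) (gr : gT -> {vspace V}) : bool :=
  directv (\sum_g gr g).

(* [zgr V g] is the homogeneous component V_g and [zact V f] the action of f. *)
Record zobj := ZObj {
  zcar :> vectType k;
  zgr : gT -> {vspace zcar};
  zact : gT -> 'End(zcar);
  zgr_full : (\sum_g zgr g)%VS = fullv;
  zgr_direct : direct_family zgr;
  zact1 : zact 1%g = \1%VF;
  zactM : forall f g, zact (f * g)%g = (zact f \o zact g)%VF;
  zact_gr : forall f g, (zact f @: zgr g)%VS = zgr (f * g * f^-1)%g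
}.

Definition zpi (V : zobj) (g : gT) : 'End(V) :=
  sumv_pi (\sum_h zgr V h)%VS g.

Lemma zpi_mem (V : zobj) g v : zpi V g v \in zgr V g.
Proof. exact: memv_sum_pi. Qed.

Lemma zpi_sum (V : zobj) v : \sum_g zpi V g v = v.
Proof. by apply: sumv_pi_sum; rewrite zgr_full memvf. Qed.

Lemma zpi_hom (V : zobj) g h v :
  v \in zgr V h -> zpi V g v = if g == h then v else 0.
Proof.
move=> vh; pose us i := zpi V i v; pose vs i := if i == h then v else 0.
have usP i : true -> us i \in zgr V i by move=> _; exact: zpi_mem.
have vsP i : true -> vs i \in zgr V i.
  by move=> _; rewrite /vs; case: eqP => [->|_] //; rewrite mem0v.
have := directv_sum_unique (zgr_direct V) us vs usP vsP.
rewrite zpi_sum -big_mkcond big_pred1_eq eqxx => /esym/forallP/(_ g).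
by move/eqP.
Qed.

Lemma zact_mem (V : zobj) f g v :
  v \in zgr V g -> zact V f v \in zgr V (f * g * f^-1)%g.
Proof. by move=> vg; rewrite -zact_gr memv_img. Qed.

Lemma zactK (V : zobj) f : cancel (zact V f) (zact V f^-1%g).
Proof.
by move=> v; rewrite -comp_lfunE -zactM mulVg zact1 id_lfunE.
Qed.

Lemma zactVK (V : zobj) f : cancel (zact V f^-1%g) (zact V f).
Proof.
by move=> v; rewrite -comp_lfunE -zactM mulgV zact1 id_lfunE.
Qed.

Lemma zhom_ext (V : zobj) (W : vectType k) (f g : 'Hom(V, W)) :
  (forall h v, v \in zgr V h -> f v = g v) -> f = g.
Proof.
move=> fg; apply/lfunP => v; rewrite -[v]zpi_sum !linear_sum.
by apply: eq_bigr => h _ /=; rewrite (fg h) ?zpi_mem.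
Qed.

Lemma direct_of_pi (V : vectType k) (gr : gT -> {vspace V})
    (p : gT -> 'End(V)) :
  (forall g h v, v \in gr h -> p g v = if g == h then v else 0) ->
  direct_family gr.
Proof.
move=> pP; apply/directv_sum_independent => us usP us0 i _.
have := congr1 (p i) us0; rewrite linear0 linear_sum (bigD1 i) //=.
rewrite (pP i i) ?eqxx ?usP // big1 ?addr0 // => j /negPf ji.
by rewrite (pP i j) ?usP // eq_sym ji.
Qed.

Lemma full_of_mem (V : vectType k) (gr : gT -> {vspace V}) :
  (forall v, v \in (\sum_g gr g)%VS) -> (\sum_g gr g)%VS = fullv.
Proof.
move=> H; apply/eqP; rewrite eqEsubv subvf /=; apply/subvP=> v _; exact: H.
Qed.

Lemma act_gr_of_sub (V : vectType k) (gr : gT -> {vspace V})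
    (act : gT -> 'End(V)) :
  act 1%g = \1%VF ->
  (forall f g, act (f * g)%g = (act f \o act g)%VF) ->
  (forall f g, (act f @: gr g <= gr (f * g * f^-1)%g)%VS) ->
  forall f g, (act f @: gr g)%VS = gr (f * g * f^-1)%g.
Proof.
move=> act1 actM sub f g; apply/eqP; rewrite eqEsubv sub /=.
have := limgS (act f) (sub f^-1%g (f * g * f^-1)%g).
by rewrite -limg_comp -actM mulgV act1 lim1g !mulgA mulVg mul1g mulgK.
Qed.

Definition zhom_pred (V U : zobj) : {pred 'Hom(V, U)} :=
  [pred f | [forall g, (f @: zgr V g <= zgr U g)%VS] &&
            [forall g, (f \o zact V g == zact U g \o f)%VF]].
Arguments zhom_pred V U : clear implicits.

Lemma zhom_predP (V U : zobj) (f : 'Hom(V, U)) :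
  reflect ((forall g v, v \in zgr V g -> f v \in zgr U g) /\
           (forall g v, f (zact V g v) = zact U g (f v)))
          (f \in zhom_pred V U).
Proof.
apply: (iffP andP) => -[H1 H2]; split.
- move=> g v vg; apply: (subvP (forallP H1 g)); exact: memv_img.
- by move=> g v; have /eqP/lfunP/(_ v) := forallP H2 g; rewrite !comp_lfunE.
- by apply/forallP=> g; apply/subvP=> _ /memv_imgP[v vg ->]; exact: H1.
- by apply/forallP=> g; apply/eqP/lfunP => v; rewrite !comp_lfunE.
Qed.

Fact zhom_submod_closed (V U : zobj) : submod_closed (zhom_pred V U).
Proof.
split=> [|a f g /zhom_predP[f1 f2] /zhom_predP[g1 g2]]; apply/zhom_predP.
  by split=> [g v _|g v]; rewrite !zero_lfunE ?mem0v ?linear0.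
split=> [h v vh|h v]; rewrite !add_lfunE !scale_lfunE.
  by rewrite rpredD ?rpredZ ?f1 ?g1.
by rewrite f2 g2 linearP.
Qed.

HB.instance Definition _ (V U : zobj) :=
  GRing.isSubmodClosed.Build k 'Hom(V, U) (zhom_pred V U)
    (zhom_submod_closed V U).

Record zhom (V U : zobj) := ZHom {
  zhom_val :> 'Hom(V, U);
  zhom_valP : zhom_val \in zhom_pred V U
}.

HB.instance Definition _ (V U : zobj) := [isSub for @zhom_val V U].
HB.instance Definition _ (V U : zobj) := [Choice of zhom V U by <:].
HB.instance Definition _ (V U : zobj) :=
  [SubChoice_isSubLmodule of zhom V U by <:].

Lemma zhom_gr (V U : zobj) (f : zhom V U) g v :
  v \in zgr V g -> f v \in zgr U g.
Proof. by case/zhom_predP: (zhom_valP f) => H _; exact: H. Qed.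

Lemma zhom_act (V U : zobj) (f : zhom V U) g v :
  f (zact V g v) = zact U g (f v).
Proof. by case/zhom_predP: (zhom_valP f) => _. Qed.

Lemma zhom_zpi (V U : zobj) (f : zhom V U) g v :
  f (zpi V g v) = zpi U g (f v).
Proof.
rewrite -[v in RHS]zpi_sum !linear_sum (bigD1 g) //= big1 => [|h hg].
  by rewrite (zpi_hom _ (zhom_gr f (zpi_mem g v))) eqxx addr0.
by rewrite (zpi_hom _ (zhom_gr f (zpi_mem h v))) eq_sym (negPf hg).
Qed.

Lemma zid_subproof (V : zobj) : \1%VF \in zhom_pred V V.
Proof. by apply/zhom_predP; split=> g v; rewrite !id_lfunE. Qed.

Definition zid (V : zobj) : zhom V V := ZHom (zid_subproof V).

Lemma zcomp_subproof (V U W : zobj) (g : zhom U W) (f : zhom V U) :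
  (g \o f)%VF \in zhom_pred V W.
Proof.
apply/zhom_predP; split=> h v; rewrite !comp_lfunE.
  by move=> vh; do 2!apply: zhom_gr.
by rewrite !zhom_act.
Qed.

Definition zcomp (V U W : zobj) (g : zhom U W) (f : zhom V U) : zhom V W :=
  ZHom (zcomp_subproof g f).

Definition centre_lin : linCat k.
Proof.
apply: (@LinCat k zobj zhom zid zcomp).
- move=> V U W f a g h; apply: val_inj; apply/lfunP => v /=.
  by rewrite !(comp_lfunE, add_lfunE, scale_lfunE).
- move=> V U W g a f h; apply: val_inj; apply/lfunP => v /=.
  by rewrite !(comp_lfunE, add_lfunE, scale_lfunE) linearP.
- by move=> V U W T h g f; apply: val_inj; rewrite /= comp_lfunA.
- by move=> V U f; apply: val_inj; rewrite /= comp_lfun1l.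
- by move=> V U f; apply: val_inj; rewrite /= comp_lfun1r.
Defined.

Lemma zhom_eq (V U : zobj) (f g : zhom V U) :
  zhom_val f = zhom_val g -> f = g.
Proof. exact: val_inj. Qed.

Definition zunit_gr (g : gT) : {vspace k^o} :=
  if g == 1%g then fullv else 0%VS.

Fact zunit_full : (\sum_g zunit_gr g)%VS = fullv.
Proof.
apply: full_of_mem => v; apply: (subvP (sumv_sup 1%g _ (subvv _))) => //.
by rewrite /zunit_gr eqxx memvf.
Qed.

Fact zunit_direct : direct_family zunit_gr.
Proof.
apply: (@direct_of_pi _ _ (fun g => if g == 1%g then \1%VF else 0)) => g h v.
rewrite /zunit_gr; case: (h =P 1%g) => [-> _|_].
  by case: eqP => _; rewrite ?id_lfunE ?zero_lfunE.
by rewrite memv0 => /eqP->; rewrite linear0 if_same.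
Qed.

Definition zunit : zobj.
Proof.
apply: (@ZObj k^o zunit_gr (fun=> \1%VF) zunit_full zunit_direct).
- by [].
- by move=> f g; rewrite comp_lfun1l.
- move=> f g; rewrite lim1g /zunit_gr.
  have -> : (f * g * f^-1 = g ^ f^-1)%g by rewrite conjgE invgK mulgA.
  by rewrite conjg_eq1.
Defined.

Lemma zhom_pred_inv (V U : zobj) (f : zhom V U) (g : 'Hom(U, V)) :
  cancel f g -> cancel g f -> g \in zhom_pred U V.
Proof.
move=> fK gK; apply/zhom_predP; split=> [h u uh|h u].
  suff -> : g u = zpi V h (g u) by exact: zpi_mem.
  by rewrite -[RHS]fK zhom_zpi gK (zpi_hom _ uh) eqxx.
by rewrite -[RHS]fK zhom_act gK.
Qed.

Lemma centre_iso (V U : obj centre_lin) (f : zhom V U) (g : 'Hom(U, V)) :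
  cancel f g -> cancel g f -> @is_iso k centre_lin V U f.
Proof.
move=> fK gK; exists (ZHom (zhom_pred_inv fK gK)).
by split; apply: zhom_eq; apply/lfunP=> v /=; rewrite comp_lfunE id_lfunE /=.
Qed.

Definition ztens_gr (V U : zobj) (g : gT) : {vspace tensv V U} :=
  (\sum_(ab : gT * gT | (ab.1 * ab.2)%g == g)
     tens_sub (zgr V ab.1) (zgr U ab.2))%VS.

Definition ztens_act (V U : zobj) (f : gT) : 'End(tensv V U) :=
  tmap (zact V f) (zact U f).

Lemma mem_ztens_gr (V U : zobj) a b v u :
  v \in zgr V a -> u \in zgr U b -> v *t u \in ztens_gr V U (a * b)%g.
Proof.
move=> va ub.
apply: (subvP (sumv_sup (a, b) _ (subvv _))); rewrite ?eqxx //=.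
exact: mem_tens_sub.
Qed.

Lemma ztens_gr_ind (V U : zobj) g (W : vectType k) (C : {vspace W})
    (h : 'Hom(tensv V U, W)) :
  (forall a b v u, v \in zgr V a -> u \in zgr U b -> (a * b)%g = g ->
     h (v *t u) \in C) ->
  forall m, m \in ztens_gr V U g -> h m \in C.
Proof.
move=> hC m mg; have: h m \in (h @: ztens_gr V U g)%VS by exact: memv_img.
apply: subvP; rewrite limg_sum; apply/subv_sumP=> -[a b] /= /eqP abg.
by apply: limg_tens_sub => v u va ub; apply: hC va ub abg.
Qed.

Fact ztens_full (V U : zobj) : (\sum_g ztens_gr V U g)%VS = fullv.
Proof.
apply: full_of_mem => m; rewrite [m]tens_span.
rewrite rpred_sum // => i _; rewrite rpred_sum // => j _; apply: rpredZ.
move: (_`_i) (_`_j) => v u; rewrite -[v]zpi_sum -[u]zpi_sum.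
rewrite tens_suml rpred_sum // => a _; rewrite tens_sumr rpred_sum // => b _.
apply: (subvP (sumv_sup (a * b)%g _ (subvv _))) => //.
by rewrite mem_ztens_gr ?zpi_mem.
Qed.

Fact ztens_direct (V U : zobj) : direct_family (ztens_gr V U).
Proof.
pose p g : 'End(tensv V U) :=
  \sum_(ab : gT * gT | (ab.1 * ab.2)%g == g) tmap (zpi V ab.1) (zpi U ab.2).
have pE g a b v u : v \in zgr V a -> u \in zgr U b ->
    p g (v *t u) = if g == (a * b)%g then v *t u else 0.
  move=> va ub; rewrite sum_lfunE; case: eqP => [->|/eqP neq].
    rewrite (bigD1 (a, b)) //= tmapE (zpi_hom _ va) (zpi_hom _ ub) !eqxx.
    rewrite big1 ?addr0 // => -[a' b'] /andP[_ /= nab].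
    rewrite tmapE (zpi_hom _ va) (zpi_hom _ ub).
    move: nab; rewrite -pair_eqE /= negb_and.
    by case/orP=> /negPf->; rewrite ?tens0l ?tens0r.
  rewrite big1 // => -[a' b'] /= /eqP abg.
  rewrite tmapE (zpi_hom _ va) (zpi_hom _ ub).
  case: eqP => [aa|_]; last by rewrite tens0l.
  case: eqP => [bb|_]; last by rewrite tens0r.
  by rewrite -abg aa bb eqxx in neq.
apply: (@direct_of_pi _ _ p) => g h m mh; case: eqP => [->|/eqP gh].
  apply/eqP; rewrite -subr_eq0 -memv0.
  have -> : p h m - m = (p h - \1)%VF m.
    by rewrite add_lfunE opp_lfunE id_lfunE.
  apply: ztens_gr_ind mh => a b v u va ub abh.
  by rewrite memv0 add_lfunE opp_lfunE id_lfunE (pE _ _ _ _ _ va ub) abh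
             eqxx subrr.
apply/eqP; rewrite -memv0; apply: ztens_gr_ind mh => a b v u va ub abh.
by rewrite memv0 (pE _ _ _ _ _ va ub) abh (negPf gh).
Qed.

Fact ztens_act1 (V U : zobj) : ztens_act V U 1%g = \1%VF.
Proof.
by apply: tens_ext => v u; rewrite tmapE !zact1 !id_lfunE.
Qed.

Fact ztens_actM (V U : zobj) f g :
  ztens_act V U (f * g)%g = (ztens_act V U f \o ztens_act V U g)%VF.
Proof.
by apply: tens_ext => v u; rewrite comp_lfunE !tmapE !zactM !comp_lfunE.
Qed.

Fact ztens_act_gr (V U : zobj) f g :
  (ztens_act V U f @: ztens_gr V U g <= ztens_gr V U (f * g * f^-1)%g)%VS.
Proof.
apply/subvP=> _ /memv_imgP[m mg ->]; apply: ztens_gr_ind mg => a b v u va ub <-.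
have -> : (f * (a * b) * f^-1 = (f * a * f^-1) * (f * b * f^-1))%g.
  by rewrite !mulgA mulgKV.
by rewrite tmapE mem_ztens_gr ?zact_mem.
Qed.

Definition ztens (V U : zobj) : zobj :=
  ZObj (ztens_full V U) (ztens_direct V U) (ztens_act1 V U) (@ztens_actM V U)
    (act_gr_of_sub (ztens_act1 V U) (@ztens_actM V U) (@ztens_act_gr V U)).

Lemma zact_tens (V U : zobj) f v u :
  zact (ztens V U) f (v *t u) = zact V f v *t zact U f u.
Proof. exact: tmapE. Qed.

Lemma zhom_pred_tens (V U W : zobj) (f : 'Hom(ztens V U, W)) :
  (forall a b v u, v \in zgr V a -> u \in zgr U b ->
     f (v *t u) \in zgr W (a * b)%g) ->
  (forall g v u, f (zact V g v *t zact U g u) = zact W g (f (v *t u))) ->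
  f \in zhom_pred (ztens V U) W.
Proof.
move=> fgr fact; apply/zhom_predP; split=> [g m|g m].
  by apply: ztens_gr_ind => a b v u va ub <-; exact: fgr.
rewrite -!comp_lfunE; move: m; apply/lfunP; apply: tens_ext => v u.
by rewrite !comp_lfunE zact_tens fact.
Qed.

Lemma ztens_ext (V U : zobj) (W : vectType k) (f g : 'Hom(tensv V U, W)) :
  (forall a v u, v \in zgr V a -> f (v *t u) = g (v *t u)) -> f = g.
Proof.
move=> fg; apply: tens_ext => v u; rewrite -[v]zpi_sum tens_suml !linear_sum.
by apply: eq_bigr => a _ /=; rewrite (fg a) ?zpi_mem.
Qed.

Lemma ztensm_subproof (V V' U U' : zobj) (f : zhom V V') (g : zhom U U') :
  tmap f g \in zhom_pred (ztens V U) (ztens V' U').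
Proof.
apply: zhom_pred_tens => [a b v u va ub|h v u]; rewrite tmapE.
  by rewrite mem_ztens_gr ?zhom_gr.
by rewrite !zhom_act tmapE zact_tens.
Qed.

Definition ztensm (V V' U U' : zobj) (f : zhom V V') (g : zhom U U') :
    zhom (ztens V U) (ztens V' U') :=
  ZHom (ztensm_subproof f g).

Lemma zassoc_subproof (V U W : zobj) :
  tassoc V U W \in zhom_pred (ztens (ztens V U) W) (ztens V (ztens U W)).
Proof.
apply/zhom_predP; split=> [g|g m]; last first.
  rewrite -!comp_lfunE; move: m; apply/lfunP; apply: tens_ext3l => v u w.
  by rewrite !comp_lfunE (@zact_tens (ztens V U)) zact_tens tassocE tassocE
     (@zact_tens V (ztens U W)) zact_tens.

apply: ztens_gr_ind => c d m w mc wd <-.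
have -> : tassoc V U W (m *t w) = (tassoc V U W \o rtens _ w)%VF m.
  by rewrite comp_lfunE rtensE.
apply: ztens_gr_ind mc => a b v u va ub <-.
by rewrite comp_lfunE rtensE tassocE -mulgA !mem_ztens_gr.
Qed.

Definition zassoc (V U W : zobj) :
    zhom (ztens (ztens V U) W) (ztens V (ztens U W)) :=
  ZHom (zassoc_subproof V U W).

Lemma tassocK (V U W : vectType k) : cancel (tassoc V U W) (tassocV V U W).
Proof.
move=> m; rewrite -comp_lfunE -[RHS]id_lfunE; move: m; apply/lfunP.
by apply: tens_ext3l => v u w; rewrite comp_lfunE tassocE tassocVE id_lfunE.
Qed.

Lemma tassocVK (V U W : vectType k) : cancel (tassocV V U W) (tassoc V U W).
Proof.
move=> m; rewrite -comp_lfunE -[RHS]id_lfunE; move: m; apply/lfunP.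
by apply: tens_ext3r => v u w; rewrite comp_lfunE tassocVE tassocE id_lfunE.
Qed.

Definition zassocV (V U W : zobj) :
    zhom (ztens V (ztens U W)) (ztens (ztens V U) W) :=
  ZHom (@zhom_pred_inv _ _ (zassoc V U W) (tassocV V U W)
          (@tassocK V U W) (@tassocVK V U W)).

Lemma zlunit_subproof (V : zobj) :
  tlunit V \in zhom_pred (ztens zunit V) V.
Proof.
apply: zhom_pred_tens => [a b x v|g x v]; rewrite !tlunitE.
  rewrite /= /zunit_gr; case: eqP => [-> _ vb|_].
    by rewrite mul1g rpredZ.
  by rewrite memv0 => /eqP-> _; rewrite scale0r mem0v.
by rewrite /= id_lfunE linearZ.
Qed.

Definition zlunit (V : zobj) : zhom (ztens zunit V) V :=
  ZHom (zlunit_subproof V).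

Lemma zrunit_subproof (V : zobj) :
  trunit V \in zhom_pred (ztens V zunit) V.
Proof.
apply: zhom_pred_tens => [a b v x|g v x]; rewrite !trunitE.
  rewrite /= /zunit_gr => va; case: eqP => [-> _|_].
    by rewrite mulg1 rpredZ.
  by rewrite memv0 => /eqP->; rewrite scale0r mem0v.
by rewrite /= id_lfunE linearZ.
Qed.

Definition zrunit (V : zobj) : zhom (ztens V zunit) V :=
  ZHom (zrunit_subproof V).

Definition centre_mon : monCat k.
Proof.
apply: (@MonCat k centre_lin zunit ztens ztensm _ _ _ _ zassoc zassocV _ _ _
          zlunit _ _ zrunit).
- move=> V V' U U' g a f f'; apply: zhom_eq; apply: tens_ext => v u /=.
  rewrite !(add_lfunE, scale_lfunE) !tmapE !(add_lfunE, scale_lfunE).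
  exact: tens_linear_l.
- move=> V V' U U' f a g g'; apply: zhom_eq; apply: tens_ext => v u /=.
  rewrite !(add_lfunE, scale_lfunE) !tmapE !(add_lfunE, scale_lfunE).
  exact: tens_linear_r.
- move=> V U; apply: zhom_eq; apply: tens_ext => v u /=.
  by rewrite tmapE !id_lfunE.
- move=> V V' V'' U U' U'' f' f g' g; apply: zhom_eq.
  by apply: tens_ext => v u /=; rewrite !(comp_lfunE, tmapE).
- move=> V U W; apply: zhom_eq; apply/lfunP => m /=.
  by rewrite comp_lfunE id_lfunE /= tassocK.
- move=> V U W; apply: zhom_eq; apply/lfunP => m /=.
  by rewrite comp_lfunE id_lfunE /= tassocVK.
- move=> V V' U U' W W' f g h; apply: zhom_eq; apply: tens_ext3l => v u w /=.
  by rewrite !(comp_lfunE, tmapE, tassocE).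
- move=> V; apply: (@centre_iso (ztens zunit V) V (zlunit V)
                 (ltens V (1 : k^o))) => [m|v] /=.
    rewrite -comp_lfunE -[RHS]id_lfunE; move: m; apply/lfunP.
    apply: tens_ext => x v; rewrite comp_lfunE tlunitE ltensE id_lfunE.
    by rewrite tensZr -tensZl; congr (_ *t _); exact: mulr1.
  by rewrite ltensE tlunitE scale1r.
- move=> V U f; apply: zhom_eq; apply: tens_ext => x v /=.
  by rewrite !comp_lfunE tmapE !tlunitE id_lfunE linearZ.
- move=> V; apply: (@centre_iso (ztens V zunit) V (zrunit V)
                 (rtens V (1 : k^o))) => [m|v] /=.
    rewrite -comp_lfunE -[RHS]id_lfunE; move: m; apply/lfunP.
    apply: tens_ext => v x; rewrite comp_lfunE trunitE rtensE id_lfunE.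
    by rewrite tensZl -tensZr; congr (_ *t _); exact: mulr1.
  by rewrite rtensE trunitE scale1r.
- move=> V U f; apply: zhom_eq; apply: tens_ext => v x /=.
  by rewrite !comp_lfunE tmapE !trunitE id_lfunE linearZ.
- move=> V U; apply: zhom_eq; apply: tens_ext3l => v x u /=.
  rewrite !comp_lfunE tassocE !tmapE tlunitE trunitE !id_lfunE.
  by rewrite tensZl tensZr.
- by move=> V U W T; apply: zhom_eq; exact: tpentagon.
Defined.

(* v (x) u |-> f(u) (x) v for v homogeneous of degree f, see [tbraidE]. *)
Definition tbraid (V U : zobj) : 'Hom(tensv V U, tensv U V) :=
  tlift (fun v u => \sum_f zact U f u *t zpi V f v).

Lemma tbraidE (V U : zobj) f v u :
  v \in zgr V f -> tbraid V U (v *t u) = zact U f u *t v.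
Proof.
move=> vf; rewrite tliftE => [|x|x] /=; first last.
- move=> a y z; rewrite scaler_sumr -big_split; apply: eq_bigr => h _.
  by rewrite linearP tens_linear_l.
- move=> a y z; rewrite scaler_sumr -big_split; apply: eq_bigr => h _.
  by rewrite linearP tens_linear_r.
rewrite (bigD1 f) //= big1 => [|h /negPf hf]; rewrite (zpi_hom _ vf).
  by rewrite eqxx addr0.
by rewrite hf tens0r.
Qed.

Definition tbraidV (V U : zobj) : 'Hom(tensv U V, tensv V U) :=
  tlift (fun u v => \sum_f zpi V f v *t zact U f^-1%g u).

Lemma tbraidVE (V U : zobj) f v u :
  v \in zgr V f -> tbraidV V U (u *t v) = v *t zact U f^-1%g u.
Proof.
move=> vf; rewrite tliftE => [|x|x] /=; first last.
- move=> a y z; rewrite scaler_sumr -big_split; apply: eq_bigr => h _.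
  by rewrite linearP tens_linear_l.
- move=> a y z; rewrite scaler_sumr -big_split; apply: eq_bigr => h _.
  by rewrite linearP tens_linear_r.
rewrite (bigD1 f) //= big1 => [|h /negPf hf]; rewrite (zpi_hom _ vf).
  by rewrite eqxx addr0.
by rewrite hf tens0l.
Qed.

Lemma zact_deg (V : zobj) f v : v \in zgr V f -> zact V f v \in zgr V f.
Proof. by move=> vf; have := zact_mem f vf; rewrite mulgK. Qed.

Lemma zbraid_subproof (V U : zobj) :
  tbraid V U \in zhom_pred (ztens V U) (ztens U V).
Proof.
apply: zhom_pred_tens => [a b v u va ub|g v u].
  rewrite (tbraidE _ va) -[(a * b)%g](mulgKV a).
  by rewrite mem_ztens_gr ?zact_mem.
have: v \in (\sum_a zgr V a)%VS by rewrite zgr_full memvf.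
case/memv_sumP=> vs vsP ->; rewrite linear_sum !tens_suml !linear_sum.
apply: eq_bigr => a _; have va := vsP a isT.
rewrite /= (tbraidE _ va) (tbraidE _ (zact_mem g va)) zact_tens.
by rewrite -[RHS]/(zact U g _ *t _) -!comp_lfunE -!zactM mulgKV.
Qed.

Definition zbraid (V U : zobj) : zhom (ztens V U) (ztens U V) :=
  ZHom (zbraid_subproof V U).

Lemma ztens_ext3l (V U : zobj) (W T : vectType k)
    (f g : 'Hom(tensv (tensv V U) W, T)) :
  (forall a b v u w, v \in zgr V a -> u \in zgr U b ->
     f ((v *t u) *t w) = g ((v *t u) *t w)) -> f = g.
Proof.
move=> fg; apply: tens_ext3l => v u w; rewrite -[v]zpi_sum -[u]zpi_sum.
rewrite !tens_suml !linear_sum; apply: eq_bigr => a _ /=.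
rewrite tens_sumr tens_suml !linear_sum; apply: eq_bigr => b _ /=.
by rewrite (fg a b) ?zpi_mem.
Qed.

Lemma ztens_ext3r (V U : zobj) (W T : vectType k)
    (f g : 'Hom(tensv V (tensv U W), T)) :
  (forall a b v u w, v \in zgr V a -> u \in zgr U b ->
     f (v *t (u *t w)) = g (v *t (u *t w))) -> f = g.
Proof.
move=> fg; apply: tens_ext3r => v u w; rewrite -[v]zpi_sum -[u]zpi_sum.
rewrite !tens_suml !linear_sum; apply: eq_bigr => a _ /=.
rewrite tens_sumr !linear_sum; apply: eq_bigr => b _ /=.
by rewrite (fg a b) ?zpi_mem.
Qed.

Definition drinfeld_centre : braidedCat k.
Proof.
apply: (@BraidedCat k centre_mon zbraid).
- move=> V U; apply: (@centre_iso (ztens V U) (ztens U V) (zbraid V U)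
                        (tbraidV V U)) => m /=.
    rewrite -comp_lfunE -[RHS]id_lfunE; move: m; apply/lfunP.
    apply: ztens_ext => a v u va.
    by rewrite comp_lfunE (tbraidE _ va) (tbraidVE _ va) zactK id_lfunE.
  rewrite -comp_lfunE -[RHS]id_lfunE; move: m; apply/lfunP.
  apply: tens_ext => u v; rewrite -[v]zpi_sum tens_sumr !linear_sum.
  apply: eq_bigr => a _; have va := zpi_mem a v.
  by rewrite /= comp_lfunE (tbraidVE _ va) (tbraidE _ va) zactVK id_lfunE.
- move=> V V' U U' f g; apply: zhom_eq; apply: ztens_ext => a v u va /=.
  rewrite !comp_lfunE tmapE (tbraidE _ va) (tbraidE _ (zhom_gr f va)) tmapE.
  by rewrite zhom_act.
- move=> V U W; apply: zhom_eq; apply: ztens_ext3l => a b v u w va ub /=.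
  rewrite !comp_lfunE tassocE (@tbraidE V (ztens U W) _ _ _ va) zact_tens.
  rewrite tmapE (tbraidE _ va) !tassocE tmapE (tbraidE _ va).
  by rewrite !id_lfunE.
- move=> V U W; apply: zhom_eq; apply: ztens_ext3r => a b v u w va ub /=.
  rewrite !comp_lfunE tassocVE tmapE (tbraidE _ ub) id_lfunE.
  rewrite (@tbraidE (ztens V U) W _ _ _ (mem_ztens_gr va ub)) !tassocVE.
  by rewrite tmapE (tbraidE _ va) zactM comp_lfunE id_lfunE.
Defined.

Definition dualv (V : vectType k) : vectType k := 'Hom(V, k^o).

Definition precomp_fun (V : vectType k) (h : 'End(V)) (l : dualv V) : dualv V :=
  (l \o h)%VF.

Fact precomp_is_linear (V : vectType k) (h : 'End(V)) :
  linear (precomp_fun h).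
Proof. by move=> a l l'; rewrite /precomp_fun comp_lfunDl comp_lfunZl. Qed.

HB.instance Definition _ (V : vectType k) (h : 'End(V)) :=
  GRing.isLinear.Build k (dualv V) (dualv V) _ (precomp_fun h)
    (precomp_is_linear h).

Definition precomp (V : vectType k) (h : 'End(V)) : 'End(dualv V) :=
  linfun (precomp_fun h).

Lemma precompE (V : vectType k) (h : 'End(V)) (l : dualv V) v :
  precomp h l v = l (h v).
Proof. by rewrite lfunE /= comp_lfunE. Qed.

(* The dual of V_(g^-1), its elements being extended by 0 on the other
   homogeneous components; see [mem_zdual_gr]. *)
Definition zdual_gr (V : zobj) (g : gT) : {vspace dualv V} :=
  limg (precomp (zpi V g^-1%g)).

Definition zdual_act (V : zobj) (f : gT) : 'End(dualv V) :=
  precomp (zact V f^-1%g).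

Lemma zpiK (V : zobj) g h v :
  zpi V g (zpi V h v) = if g == h then zpi V h v else 0.
Proof. exact: zpi_hom (zpi_mem h v). Qed.

Lemma mem_zdual_gr (V : zobj) g (l : dualv V) :
  l \in zdual_gr V g <->
  (forall h v, h != g^-1%g -> v \in zgr V h -> l v = 0).
Proof.
split=> [/memv_imgP[l' _ ->] h v hg vh|lP].
  by rewrite precompE (zpi_hom _ vh) eq_sym (negPf hg) linear0.
apply/memv_imgP; exists l; first exact: memvf.
apply/zhom_ext => h v vh; rewrite precompE (zpi_hom _ vh).
case: eqP => // /eqP; rewrite eq_sym => hg.
by rewrite linear0 (lP h v hg vh).
Qed.

Fact zdual_full (V : zobj) : (\sum_g zdual_gr V g)%VS = fullv.
Proof.
apply: full_of_mem => l.
have -> : l = \sum_g precomp (zpi V g^-1%g) l.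
  apply/lfunP => v; rewrite sum_lfunE -[v in LHS]zpi_sum linear_sum.
  rewrite (reindex_inj invg_inj) /=.
  by apply: eq_bigr => g _; rewrite precompE.
rewrite rpred_sum // => g _.
apply: (subvP (sumv_sup g _ (subvv _))) => //.
by rewrite memv_img ?memvf.
Qed.

Fact zdual_direct (V : zobj) : direct_family (zdual_gr V).
Proof.
apply: (@direct_of_pi _ _ (fun g => precomp (zpi V g^-1%g))) => g h l.
move=> /memv_imgP[l' _ ->]; apply/lfunP => v; rewrite !precompE zpiK.
rewrite eq_sym (inj_eq invg_inj); case: eqP => [->|_].
  by rewrite precompE.
by rewrite linear0 zero_lfunE.
Qed.

Fact zdual_act1 (V : zobj) : zdual_act V 1%g = \1%VF.
Proof.
by apply/lfunP=> l; apply/lfunP=> v; rewrite precompE invg1 zact1 !id_lfunE.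
Qed.

Fact zdual_actM (V : zobj) f g :
  zdual_act V (f * g)%g = (zdual_act V f \o zdual_act V g)%VF.
Proof.
apply/lfunP=> l; apply/lfunP=> v.
by rewrite comp_lfunE !precompE invMg zactM comp_lfunE.
Qed.

Fact zdual_act_gr (V : zobj) f g :
  (zdual_act V f @: zdual_gr V g <= zdual_gr V (f * g * f^-1)%g)%VS.
Proof.
apply/subvP=> _ /memv_imgP[l /mem_zdual_gr lP ->]; apply/mem_zdual_gr.
move=> h v hg vh; rewrite precompE; apply: lP (zact_mem _ vh).
apply: contra hg => /eqP hg; apply/eqP.
by rewrite !invMg invgK -hg !mulgA invgK mulgV mul1g mulgK.
Qed.

Definition zdual (V : zobj) : zobj :=
  ZObj (zdual_full V) (zdual_direct V) (zdual_act1 V) (@zdual_actM V)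
    (act_gr_of_sub (zdual_act1 V) (@zdual_actM V) (@zdual_act_gr V)).

Lemma zact_dual (V : zobj) f (l : dualv V) v :
  zact (zdual V) f l v = l (zact V f^-1%g v).
Proof. exact: precompE. Qed.

End Centre.

Definition dualising (k : fieldType) (gT : finGroupType)
    (F : linFunctor (drinfeld_centre k gT) (drinfeld_centre k gT)) : Prop :=
  forall X : obj (drinfeld_centre k gT), isomorphic (F X) (zdual X).

Definition double_class_inverting (gT : finGroupType) (phi : {perm gT}) : Prop :=
  forall f g : gT, commute f g ->
    exists h : gT,
      phi f = (h * f^-1 * h^-1)%g /\ phi g = (h * g^-1 * h^-1)%g.

(* Main.v *)
(* For an object [X] of the centre let [chi_X (g, f)] be the trace of [g] on
   [X_f]; it vanishes unless [g] and [f] commute, and in characteristic zero it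
   determines [X] up to isomorphism.

   Twisting gradings and actions by an automorphism [phi] is a braided
   autoequivalence, and double class inversion says that it moves [chi_X] to
   [chi_(X^* )], so it is dualising.

   Conversely let [F] be dualising. Let [E_f] be the object induced from a line in
   degree [f], so that [Hom (E_f, X) = X_f]; its underlying space is that of
   functions on the group. [A = E_1] is the commutative algebra of functions, it
   acts on [E_f], and its automorphisms are the right translations. Since [F A] is
   trivially graded, it is a commutative algebra in the usual sense; a character
   of it gives an isomorphism [F A = A], and [F] acts on right translations by an
   automorphism [phi]. The double braiding of [A] and [E_f] is right translation
   by [f], which forces [F E_f] to be generated by a line in degree [phi f], on
   which translations act through [phi] up to scalars. Hence
   [chi_X (g, f) = c * chi_(F X) (phi g, phi f) = c * chi_X (phi g^-1, phi f^-1)]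
   with [c] independent of [X], and the characters of all objects separate the
   conjugacy classes of commuting pairs. *)
Require Import Defs.
From HB Require Import structures.
From mathcomp Require Import all_boot all_order all_algebra all_fingroup.

Set Implicit Arguments.
Unset Strict Implicit.
Unset Printing Implicit Defensive.

Import GRing.Theory.
Local Open Scope ring_scope.

(** * Traces and eigenvectors *)

Section Trace.
Variable k : fieldType.
Implicit Types V U W : vectType k.

Definition ltrace V (f : 'End(V)) : k :=
  \sum_i coord (vbasis {:V}) i (f (vbasis {:V})`_i).

Lemma coord_full V (v : V) :
  v = \sum_i coord (vbasis {:V}) i v *: (vbasis {:V})`_i.
Proof. by rewrite {1}(coord_vbasis (memvf v)). Qed.

Lemma coord_vbasisE V (i j : 'I_(\dim {:V})) :
  coord (vbasis {:V}) i (vbasis {:V})`_j = (i == j)%:R.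
Proof. by rewrite (coord_free _ _ (basis_free (vbasisP {:V}))) eq_sym. Qed.

Lemma ltrace_is_scalar V : scalar (@ltrace V).
Proof.
move=> a f g; rewrite /ltrace mulr_sumr -big_split; apply: eq_bigr => i _.
by rewrite add_lfunE scale_lfunE linearP.
Qed.
HB.instance Definition _ V :=
  GRing.isLinear.Build k 'End(V) k *%R (@ltrace V) (@ltrace_is_scalar V).

Lemma linear_lfunE V U (h : V -> U) : linear h -> linfun h =1 h.
Proof.
move=> hl; pose hL : {linear V -> U} :=
  HB.pack h (GRing.isLinear.Build k V U _ h hl).
exact: (lfunE hL).
Qed.

Definition lcoord V (i : 'I_(\dim {:V})) : 'Hom(V, k^o) :=
  linfun (fun v => coord (vbasis {:V}) i v : k^o).

Lemma lcoordE V i v : lcoord i v = coord (vbasis {:V}) i v.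
Proof. by rewrite linear_lfunE // => a x y; rewrite linearP. Qed.

(** Expanding each [e i] in the fixed basis and exchanging the two sums gives back the definition.
    Traces thus become computable on indicator functions, rank-one maps or matrix coordinates. *)
Lemma ltrace_dual_family (I : finType) V (e : I -> V) (d : I -> 'Hom(V, k^o))
    (f : 'End(V)) :
  (forall v, v = \sum_i (d i v : k) *: e i) ->
  ltrace f = \sum_i d i (f (e i)).
Proof.
move=> ed.
have E i : d i (f (e i)) = \sum_j coord (vbasis {:V}) j (e i)
    * d i (f (vbasis {:V})`_j).
  rewrite [in LHS](coord_full (e i)) !linear_sum; apply: eq_bigr => j _.
  by rewrite /= !linearZ.
rewrite (eq_bigr _ (fun i _ => E i)) exchange_big; apply: eq_bigr => j _ /=.
rewrite [in LHS](ed (f _)) linear_sum; apply: eq_bigr => i _ /=.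
by rewrite linearZ mulrC.
Qed.

Lemma ltrace_comp V U (f : 'Hom(V, U)) (g : 'Hom(U, V)) :
  ltrace (g \o f)%VF = ltrace (f \o g)%VF.
Proof.
have E (V' U' : vectType k) (f' : 'Hom(V', U')) (g' : 'Hom(U', V')) :
    ltrace (g' \o f')%VF = \sum_(i < \dim {:V'}) \sum_(j < \dim {:U'})
      coord (vbasis {:U'}) j (f' (vbasis {:V'})`_i) * coord (vbasis {:V'}) i
        (g' (vbasis {:U'})`_j).
  apply: eq_bigr => i _; rewrite comp_lfunE [in LHS](coord_full (f' _)).
  by rewrite !linear_sum; apply: eq_bigr => j _ /=; rewrite !linearZ.
rewrite !E exchange_big; apply: eq_bigr => j _; apply: eq_bigr => i _.
by rewrite mulrC.
Qed.

Lemma ltrace1 V : ltrace (\1%VF : 'End(V)) = (\dim {:V})%:R.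
Proof.
rewrite /ltrace (eq_bigr (fun=> 1)); first by rewrite sumr_const card_ord.
by move=> i _; rewrite id_lfunE coord_vbasisE eqxx.
Qed.

Definition rank_one V U (l : 'Hom(V, k^o)) (u : U) : 'Hom(V, U) :=
  linfun (fun v => (l v : k) *: u).

Lemma rank_oneE V U (l : 'Hom(V, k^o)) (u : U) v :
  rank_one l u v = (l v : k) *: u.
Proof.
by rewrite linear_lfunE // => a x y; rewrite linearP scalerDl -scalerA.
Qed.

(** Identifying ['Hom(V, U)] with the dual of [V] tensored with [U] makes [T] the tensor product of
    [a] with the transpose of [b]; rank-one maps provide the dual family. *)
Lemma ltrace_sandwich V U (a : 'End(U)) (b : 'End(V)) (T : 'End('Hom(V, U))) :
  (forall h, T h = (a \o h \o b)%VF) -> ltrace T = ltrace a * ltrace b.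
Proof.
move=> TE.
pose ev (x : V) : 'Hom('Hom(V, U), U) := linfun (fun h : 'Hom(V, U) => h x).
have evE x h : ev x h = h x.
  by rewrite linear_lfunE // => c f g; rewrite add_lfunE scale_lfunE.
pose e (ij : 'I_(\dim {:V}) * 'I_(\dim {:U})) :=
  rank_one (lcoord ij.1) (vbasis {:U})`_ij.2.
pose d (ij : 'I_(\dim {:V}) * 'I_(\dim {:U})) :=
  (lcoord ij.2 \o ev (vbasis {:V})`_ij.1)%VF.
rewrite (@ltrace_dual_family _ _ e d) => [|h].
  rewrite -(pair_bigA _ (fun (i : 'I_(\dim {:V})) (j : 'I_(\dim {:U})) =>
    d (i, j) (T (e (i, j))))) /=.
  rewrite exchange_big /ltrace big_distrl; apply: eq_bigr => j _ /=.
  rewrite big_distrr; apply: eq_bigr => i _ /=.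
  rewrite TE comp_lfunE evE !comp_lfunE rank_oneE !lcoordE.
  by rewrite !linearZ mulrC.
apply/lfunP => v; rewrite sum_lfunE.
under eq_bigr do rewrite scale_lfunE rank_oneE comp_lfunE evE.
rewrite -(pair_bigA _ (fun (i : 'I_(\dim {:V})) (j : 'I_(\dim {:U})) =>
  (lcoord j (h (vbasis {:V})`_i) : k) *:
  ((lcoord i v : k) *: (vbasis {:U})`_j))) /=.
rewrite [in LHS](coord_full v) linear_sum; apply: eq_bigr => i _ /=.
rewrite linearZ /= [in LHS](coord_full (h _)) scaler_sumr.
by apply: eq_bigr => j _; rewrite !lcoordE !scalerA mulrC.
Qed.

(** An idempotent factors through its image as [i \o q] with [q \o i] the identity, so cyclicity of
    the trace applies. *)
Lemma ltrace_idem V (p : 'End(V)) :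
  (p \o p)%VF = p -> ltrace p = (\dim (limg p))%:R.
Proof.
move=> pp; pose i : 'Hom(subvs_of (limg p), V) := linfun vsval.
pose q : 'Hom(V, subvs_of (limg p)) := (linfun (vsproj (limg p)) \o p)%VF.
have mp v : p v \in limg p by rewrite memv_img ?memvf.
have {1}-> : p = (i \o q)%VF.
  by apply/lfunP => v; rewrite !comp_lfunE !lfunE /= vsprojK.
rewrite -ltrace_comp; have -> : (q \o i)%VF = \1%VF.
  apply/lfunP => v; rewrite !comp_lfunE !lfunE /=.
  apply: val_inj => /=; rewrite vsprojK //.
  by have /memv_imgP[w _ ->] := subvsP v; rewrite -comp_lfunE pp.
by rewrite ltrace1 dimvf.
Qed.

End Trace.

Section TraceMatrix.
Import VectorInternalTheory.
Variable k : fieldType.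
Implicit Types V U W : vectType k.

Lemma f2mxE V U (f : 'Hom(V, U)) x : f (r2v x) = r2v (x *m f2mx f).
Proof. by rewrite unlock /= r2vK. Qed.

(** This links the trace to the characteristic polynomial, whose subleading coefficient is the
    matrix trace up to sign. *)
Lemma ltrace_mx V (f : 'End(V)) : ltrace f = \tr (f2mx f).
Proof.
pose d i : 'Hom(V, k^o) := linfun (fun v => v2r v 0 i : k^o).
have dE i v : d i v = v2r v 0 i.
  by rewrite linear_lfunE // => a x y; rewrite linearP !mxE.
rewrite (@ltrace_dual_family k _ V (fun i => r2v (delta_mx 0 i)) d) => [|v].
  by apply: eq_bigr => i _; rewrite dE f2mxE r2vK -rowE mxE.
rewrite -[v in LHS]v2rK [v2r v]row_sum_delta linear_sum.
by apply: eq_bigr => i _; rewrite linearZ dE.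
Qed.

End TraceMatrix.

Section Eigenvectors.
Import VectorInternalTheory.
Variable k : closedFieldType.
Implicit Types V : vectType k.

Lemma root_char_eigenvector V (f : 'End(V)) a :
  root (char_poly (f2mx f)) a -> exists2 v, v != 0 & f v = a *: v.
Proof.
rewrite -eigenvalue_root_char => /eigenvalueP[x xa x0]; exists (r2v x).
  by rewrite -[0]v2rK linear0 (inj_eq (can_inj r2vK)).
by rewrite f2mxE xa linearZ.
Qed.

Lemma exists_eigenvector V (f : 'End(V)) :
  {:V}%VS != 0%VS -> exists a, exists2 v, v != 0 & f v = a *: v.
Proof.
rewrite -dimv_eq0 dimvf => V0.
have /closed_rootP[a /root_char_eigenvector ra] : size (char_poly (f2mx f)) != 1.
  by rewrite size_char_poly eqSS.
by exists a.
Qed.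

Lemma exists_eigenvector_in V (f : 'End(V)) (U : {vspace V}) :
  U != 0%VS -> (f @: U <= U)%VS ->
  exists a, exists2 v, v \in U & v != 0 /\ f v = a *: v.
Proof.
move=> U0 fU.
pose i : 'Hom(subvs_of U, V) := linfun vsval.
pose g : 'End(subvs_of U) := (linfun (vsproj U) \o f \o i)%VF.
have gE u : vsval (g u) = f (vsval u).
  rewrite !comp_lfunE !lfunE /= vsprojK //.
  by apply: (subvP fU); rewrite memv_img ?subvsP.
have [|a [u u0 gu]] := exists_eigenvector g;
  first by rewrite -dimv_eq0 dimvf dimv_eq0.
exists a; exists (vsval u); first exact: subvsP.
by rewrite -gE gu.
Qed.

(** Induction on the list: an eigenspace of the first operator inside [U] is stable under the
    others, which commute with it. *)
Lemma common_eigenvector_in V (fs : seq 'End(V)) (U : {vspace V}) :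
  U != 0%VS -> (forall f, f \in fs -> (f @: U <= U)%VS) ->
  {in fs &, forall f g, (f \o g = g \o f)%VF} ->
  exists2 v, v \in U & v != 0 /\ forall f, f \in fs -> exists a, f v = a *: v.
Proof.
elim: fs U => [|f fs IH] U U0 sU com.
  by exists (vpick U); rewrite ?memv_pick ?vpick0.
have [a [v vU [v0 fv]]] := exists_eigenvector_in U0 (sU f (mem_head _ _)).
pose U' := (U :&: lker (f - a *: \1%VF))%VS.
have U'P x : (x \in U') = (x \in U) && (f x == a *: x).
  by rewrite memv_cap memv_ker add_lfunE opp_lfunE scale_lfunE id_lfunE subr_eq0.
have [|g gfs||x] := IH U'.
- apply: contra v0 => /eqP U'0; rewrite -memv0 -U'0 U'P vU.
  exact/eqP.
- apply/subvP => _ /memv_imgP[x + ->]; rewrite !U'P => /andP[xU /eqP fx].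
  rewrite (subvP (sU g _) (g x) (memv_img _ xU)) ?inE ?gfs ?orbT //=.
  by rewrite -comp_lfunE com ?inE ?eqxx ?gfs ?orbT // comp_lfunE fx linearZ.
- by move=> g h gfs hfs; apply: com; rewrite inE ?gfs ?hfs orbT.
rewrite U'P => /andP[xU /eqP fx] [x0 xP]; exists x => //; split=> // g.
by rewrite inE => /orP[/eqP ->|/xP//]; exists a.
Qed.

(* If 0 is the only root, the characteristic polynomial is X^n, with vanishing
   subleading coefficient. *)
Lemma ltrace_eigenvector V (f : 'End(V)) : ltrace f != 0 ->
  exists2 a, a != 0 & exists2 v, v != 0 & f v = a *: v.
Proof.
rewrite ltrace_mx => tr0.
have n0 : (0 < dim V)%N.
  rewrite lt0n; apply: contra tr0 => /eqP d0.
  by rewrite /mxtrace big1 // => i; have := ltn_ord i; rewrite {2}d0.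
have [s sP] := closed_field_poly_normal (char_poly (f2mx f)).
move: sP; rewrite (monicP (char_poly_monic _)) scale1r => sP.
have [/allP s0|/allPn[a sa a0]] := boolP (all (eq_op^~ 0) s); last first.
  exists a => //; apply: root_char_eigenvector.
  by rewrite sP root_prod_XsubC.
have sn : size s = dim V.
  by apply/eqP; rewrite -eqSS -(size_prod_XsubC s id) -sP size_char_poly.
move: sP; rewrite (eq_big_seq (fun=> 'X)) => [|z /s0/eqP->]; last by rewrite subr0.
rewrite big_const_seq count_predT -Monoid.iteropE /= sn => /(congr1 (coefp (dim
  V).-1)).
rewrite /= char_poly_trace // -[iterop _ _ _ _]/('X^(dim V)) coefXn.
rewrite -[in X in (_ == X)%N](prednK n0) ltn_eqF // => /eqP.
by rewrite oppr_eq0 (negPf tr0).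
Qed.

(** [y] stabilises an eigenspace [N] of [y \o r] for some nonzero eigenvalue, hence has an
    eigenvector in [N]. Its eigenvalue is nonzero, since [y \o r = r \o y] is injective on [N]. *)
Lemma ltrace_comp_eigenvector V (y r : 'End(V)) :
  (r \o y = y \o r)%VF -> ltrace (y \o r)%VF != 0 ->
  exists2 l, l != 0 & exists2 x, x != 0 & y x = l *: x.
Proof.
move=> ry tr0; have [a a0 [v v0 yrv]] := ltrace_eigenvector tr0.
pose N := lker (y \o r - a *: \1)%VF.
have NP x : (x \in N) = (y (r x) == a *: x).
  by rewrite memv_ker add_lfunE opp_lfunE scale_lfunE id_lfunE comp_lfunE subr_eq0.
have [||l [x xN [x0 yx]]] := @exists_eigenvector_in V y N.
- by apply: contra v0 => /eqP N0; rewrite -memv0 -N0 NP -comp_lfunE yrv.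
- apply/subvP => _ /memv_imgP[x xN ->]; move: xN; rewrite !NP => /eqP xN.
  by rewrite -[r (y x)]comp_lfunE ry comp_lfunE xN linearZ.
exists l; last by exists x.
apply: contra x0 => /eqP l0; move: xN.
rewrite NP -comp_lfunE -ry comp_lfunE yx l0 scale0r linear0.
by rewrite eq_sym scaler_eq0 (negPf a0).
Qed.

End Eigenvectors.

(** * Objects with equal characters are isomorphic *)

Lemma lfun_neq0 (k : fieldType) (V U : vectType k) (f : 'Hom(V, U)) :
  f != 0 -> exists v, f v != 0.
Proof.
move=> f0; have /memv_imgP[v _ fv] := memv_pick (limg f).
exists v; rewrite -fv vpick0; apply: contra f0 => /eqP f0.
by apply/eqP/lfunP => x; apply/eqP; rewrite zero_lfunE -memv0 -f0 memv_img ?memvf.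
Qed.

Section Averaging.
Variables (k : fieldType) (gT : finGroupType).
Implicit Types V U W : zobj k gT.
Local Open Scope lfun_scope.

Definition sandwich (V U : vectType k) (a : 'End(U)) (b : 'End(V)) :
    'End('Hom(V, U)) :=
  linfun (fun h : 'Hom(V, U) => a \o h \o b).

Lemma sandwichE (V U : vectType k) (a : 'End(U)) (b : 'End(V)) h :
  sandwich a b h = a \o h \o b.
Proof.
rewrite linear_lfunE // => c f g.
by rewrite comp_lfunDr comp_lfunDl -comp_lfunZr -comp_lfunZl.
Qed.

(** The operator [h |-> q \o average h \o p], spelled out as a sum of sandwiches so that its trace
    splits into products of traces on [U] and on [V]. *)
Definition average_between V U (q : 'End(U)) (p : 'End(V)) :
    'End('Hom(V, U)) :=
  (#|gT|%:R^-1) *: \sum_g \sum_f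
     sandwich (q \o (zact U g \o zpi U f)) ((zpi V f \o zact V g^-1%g) \o p).

(** In characteristic zero this is the projection of all linear maps onto the morphisms of the
    centre. *)
Definition average V U (h : 'Hom(V, U)) : 'Hom(V, U) :=
  (#|gT|%:R^-1) *: \sum_g \sum_f
     ((zact U g \o zpi U f) \o h \o (zpi V f \o zact V g^-1%g)).

Lemma averageE V U (h : 'Hom(V, U)) v :
  average h v = (#|gT|%:R^-1) *: \sum_g \sum_f
     zact U g (zpi U f (h (zpi V f (zact V g^-1%g v)))).
Proof.
rewrite scale_lfunE sum_lfunE; congr (_ *: _); apply: eq_bigr => g _.
by rewrite sum_lfunE; apply: eq_bigr => f _; rewrite !comp_lfunE.
Qed.

Lemma average_betweenE V U (q : 'End(U)) (p : 'End(V)) h :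
  average_between q p h = q \o average h \o p.
Proof.
apply/lfunP => v; rewrite !comp_lfunE averageE linearZ scale_lfunE sum_lfunE.
rewrite scale_lfunE; congr (_ *: _).
rewrite sum_lfunE linear_sum; apply: eq_bigr => g _ /=.
rewrite !sum_lfunE linear_sum; apply: eq_bigr => f _ /=.
by rewrite sandwichE !comp_lfunE.
Qed.

Lemma average_subproof V U (h : 'Hom(V, U)) : average h \in @zhom_pred k gT V U.
Proof.
apply/zhom_predP; split=> [d v vd|t v]; rewrite !averageE.
  apply: rpredZ; apply: rpred_sum => g _; apply: rpred_sum => f _.
  have vd' := zact_mem g^-1%g vd; rewrite (zpi_hom _ vd').
  case: eqP => [->|_]; last by rewrite !linear0 mem0v.
  set e := (_ * _ * _)%g; have -> : d = (g * e * g^-1)%g.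
    by rewrite /e !mulgA invgK mulgV mul1g mulgK.
  by rewrite zact_mem ?zpi_mem.
rewrite linearZ linear_sum; congr (_ *: _) => /=.
rewrite (reindex_inj (mulgI t)) /=; apply: eq_bigr => g _.
rewrite linear_sum; apply: eq_bigr => f _ /=.
by rewrite zactM invMg zactM !comp_lfunE zactK.
Qed.

Definition zaverage V U (h : 'Hom(V, U)) : zhom V U := ZHom (average_subproof h).

Lemma average_comp V V' U U' (u : zhom U U') (h : 'Hom(V, U)) (v : zhom V' V) :
  average (u \o h \o v) = u \o average h \o v.
Proof.
apply/lfunP => x; rewrite !comp_lfunE !averageE linearZ linear_sum.
congr (_ *: _); apply: eq_bigr => g _; rewrite linear_sum.
apply: eq_bigr => f _ /=.
by rewrite !comp_lfunE -!zhom_act -!zhom_zpi -zhom_act.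
Qed.

Hypothesis hk : [pchar k] =i pred0.

Lemma natr_neq0 n : (n%:R == 0 :> k) = (n == 0)%N.
Proof. by move/pcharf0P: hk. Qed.

Lemma average_zhom V U (h : zhom V U) : average h = h.
Proof.
apply/lfunP => v; rewrite averageE (eq_bigr (fun=> h v)) => [|g _].
  rewrite sumr_const -scaler_nat scalerA mulVf ?scale1r //.
  rewrite natr_neq0 -cardsT; apply/eqP => c0.
  by have := in_setT (1%g : gT); rewrite (cards0_eq c0) inE.
rewrite (eq_bigr (fun f => zact U g (zpi U f (zact U g^-1%g (h v))))).
  by rewrite -[in RHS](zactVK g (h v)) -[in RHS](zpi_sum (zact U _ (h v)))
    linear_sum.
by move=> f _; rewrite zhom_zpi zhom_act zpiK eqxx.
Qed.

Definition zchar V g f : k := ltrace (zact V g \o zpi V f).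

Lemma zhom_zpi_comp V U (u : zhom V U) f : u \o zpi V f = zpi U f \o u.
Proof. by apply/lfunP => v; rewrite !comp_lfunE zhom_zpi. Qed.

Lemma zhom_act_comp V U (u : zhom V U) f : u \o zact V f = zact U f \o u.
Proof. by apply/lfunP => v; rewrite !comp_lfunE zhom_act. Qed.

(** Maschke's argument: the linear pseudo-inverse of [u] satisfies the equation, and averaging
    preserves it, because [average] commutes with composition by morphisms and fixes [u]. *)
Lemma zhom_regular V U (u : zhom V U) : exists w : zhom U V, u \o w \o u = u.
Proof.
exists (zaverage u^-1); rewrite /= -average_comp -[RHS]average_zhom.
by congr average; apply/lfunP => v;
  rewrite !comp_lfunE limg_lfunVK // memv_img ?memvf.
Qed.

Lemma ltrace_average_between V U (q : zhom U U) (p : zhom V V) :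
  ltrace (average_between q p) = #|gT|%:R^-1 *
    \sum_g \sum_f ltrace (q \o (zact U g \o zpi U f)) *
                  ltrace (p \o (zact V g^-1%g \o zpi V f)).
Proof.
rewrite linearZ linear_sum; congr (_ * _); apply: eq_bigr => g _ /=.
rewrite linear_sum; apply: eq_bigr => f _ /=.
rewrite (ltrace_sandwich (sandwichE _ _)); congr (_ * _).
by rewrite -comp_lfunA ltrace_comp -zhom_act_comp comp_lfunA.
Qed.

Lemma ltrace_idem_eq0 (V : vectType k) (p : 'End(V)) :
  p \o p = p -> ltrace p = 0 -> p = 0.
Proof.
move=> pp; rewrite ltrace_idem // => /eqP; rewrite natr_neq0 dimv_eq0 => /eqP p0.
apply/lfunP => v; rewrite zero_lfunE; apply/eqP.
by rewrite -memv0 -p0 memv_img ?memvf.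
Qed.

Lemma ltrace_zpi_sum V (p : 'End(V)) : ltrace p = \sum_f ltrace (p \o zpi V f).
Proof.
rewrite -linear_sum /=; congr ltrace; apply/lfunP => v.
by rewrite sum_lfunE -[v in LHS]zpi_sum linear_sum; apply: eq_bigr => f _;
  rewrite comp_lfunE.
Qed.

Section EqualCharacters.
Variables (V W : zobj k gT).
Hypothesis charE : forall g f, zchar V g f = zchar W g f.

Variables (u : zhom V W) (w : zhom W V).
Hypothesis uwu : u \o w \o u = u.

(** [p] projects [V] onto the kernel of [u]; [q] projects [W] onto a complement of the image of
    [u]. *)
Let p := zid V - (zcomp w u : zhom V V).
Let q := zid W - (zcomp u w : zhom W W).

(** By cyclicity and naturality [w \o u] and [u \o w] have the same twisted traces; by [charE] so do
    the two identities. *)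
Lemma defect_charE g f :
  ltrace (q \o (zact W g \o zpi W f)) = ltrace (p \o (zact V g \o zpi V f)).
Proof.
rewrite /= !comp_lfunDl !comp_lfunNl !comp_lfun1l !linearB /=.
rewrite -/(zchar W g f) -/(zchar V g f) charE; congr (_ - _).
rewrite -comp_lfunA ltrace_comp; congr ltrace.
by rewrite -!comp_lfunA -zhom_zpi_comp (comp_lfunA (zact W g)) -zhom_act_comp
  !comp_lfunA.
Qed.

Lemma defect_idem_l : p \o p = p.
Proof.
have wuwu : w \o u \o (w \o u) = w \o u by rewrite -comp_lfunA (comp_lfunA u) uwu.
rewrite /= comp_lfunDl comp_lfunNl !comp_lfunDr !comp_lfunNr.
by rewrite !comp_lfun1l comp_lfun1r wuwu subrr subr0.
Qed.

Lemma defect_idem_r : q \o q = q.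
Proof.
have wuwu : u \o w \o (u \o w) = u \o w by rewrite comp_lfunA uwu.
rewrite /= comp_lfunDl comp_lfunNl !comp_lfunDr !comp_lfunNr.
by rewrite !comp_lfun1l comp_lfun1r wuwu subrr subr0.
Qed.

Lemma ltrace_defect : ltrace q = ltrace p.
Proof.
rewrite ltrace_zpi_sum [RHS]ltrace_zpi_sum; apply: eq_bigr => f _.
by have := defect_charE 1%g f; rewrite !zact1 !comp_lfun1l.
Qed.

(* The two operators have equal traces, and the second one is an idempotent
   fixing [p]. *)
Lemma defect_corner : p != 0 -> exists h : zhom V W, q \o h \o p != 0.
Proof.
move=> p0; have [T0|T0] := eqVneq (average_between q p) 0; last first.
  have [h hn0] := lfun_neq0 T0.
  by exists (zaverage h); rewrite -average_betweenE.
case/negP: p0; apply/eqP; apply: zhom_eq => /=.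
have S0 : average_between p p = 0.
  apply: ltrace_idem_eq0.
    apply/lfunP => h; rewrite comp_lfunE !average_betweenE average_comp.
    by rewrite !comp_lfunA defect_idem_l -!comp_lfunA defect_idem_l !comp_lfunA
      (average_zhom (zaverage _)).
  transitivity (ltrace (average_between q p)); last by rewrite T0 linear0.
  rewrite !ltrace_average_between.
  by congr (_ * _); apply: eq_bigr => g _; apply: eq_bigr => f _;
    rewrite defect_charE.
have := congr1 (fun S : 'End('Hom(V, V)) => S p) S0.
by rewrite average_betweenE average_zhom !defect_idem_l zero_lfunE.
Qed.

Lemma quasi_inverseE x : u (w (u x)) = u x.
Proof. by rewrite -[in RHS]uwu !comp_lfunE. Qed.

(** Take [u + q \o h \o p]. The correction takes values in a complement of the image of [u], so the
    new kernel is the intersection of the two kernels; it is strictly smaller, as the correction is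
    nonzero on the image of [p], which is the kernel of [u]. *)
Lemma larger_rank : p != 0 -> exists u' : zhom V W, (\dim (lker u') < \dim
  (lker u))%N.
Proof.
move=> p0; have [h] := defect_corner p0; move/lfun_neq0 => [v].
rewrite !comp_lfunE => qhpv.
have up x : u (p x) = 0.
  rewrite add_lfunE opp_lfunE id_lfunE comp_lfunE linearB /=.
  by rewrite quasi_inverseE subrr.
have pker x : u x = 0 -> p x = x.
  by move=> ux; rewrite add_lfunE opp_lfunE id_lfunE comp_lfunE ux linear0 subr0.
have uwq x : u (w (q x)) = 0.
  rewrite add_lfunE opp_lfunE id_lfunE comp_lfunE !linearB /=.
  by rewrite quasi_inverseE subrr.
exists (u + zcomp q (zcomp h p) : zhom V W).
have kerE x : (x \in lker (u + zcomp q (zcomp h p) : zhom V W)) =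
    (u x == 0) && (q (h (p x)) == 0).
  rewrite memv_ker add_lfunE !comp_lfunE;
    apply/eqP/andP => [e|[/eqP-> /eqP->]]; last by rewrite addr0.
  have := congr1 (fun y => u (w y)) e; rewrite !linear0 !linearD /= uwq addr0.
  rewrite quasi_inverseE => ux.
  by move: e; rewrite ux add0r => ->; rewrite eqxx.
rewrite ltn_neqAle dimvS ?andbT; last first.
  by apply/subvP => x; rewrite kerE memv_ker => /andP[].
apply: contra qhpv => dimE.
have /eqP kE : lker (u + zcomp q (zcomp h p) : zhom V W) == lker u.
  by rewrite eqEdim (eqP dimE) leqnn andbT; apply/subvP => x;
    rewrite kerE memv_ker => /andP[].
by have := kerE (p v); rewrite kE memv_ker up eqxx /= pker ?up // => /esym.
Qed.

(** [q] is an idempotent with the same trace as [p], so it vanishes together with [p]. *)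
Lemma zero_defect_iso : p = 0 -> @isomorphic k (drinfeld_centre k gT) V W.
Proof.
move=> p0; have wu : w \o u = \1.
  by have /(congr1 (@zhom_val _ _ _ _))/eqP := p0; rewrite /= subr_eq0 => /eqP.
have q0 : q \o q = 0.
  by rewrite defect_idem_r; apply: ltrace_idem_eq0;
    rewrite ?defect_idem_r // ltrace_defect p0 linear0.
have uw : u \o w = \1.
  by move: q0; rewrite defect_idem_r => /eqP; rewrite /= subr_eq0 => /eqP.
by exists u, w; split; apply: zhom_eq.
Qed.
End EqualCharacters.

(** Starting from the zero morphism, the kernel is shrunk by [larger_rank] until the defect [p]
    vanishes. *)
Lemma char_isomorphic V W : (forall g f, zchar V g f = zchar W g f) ->
  @isomorphic k (drinfeld_centre k gT) V W.
Proof.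
move=> charE; suff: forall n (u : zhom V W), (\dim (lker u) < n)%N ->
    @isomorphic k (drinfeld_centre k gT) V W.
  by move/(_ _ 0 (ltnSn _)).
elim=> // n IH u un; have [w uwu] := zhom_regular u.
have [p0|p0] := eqVneq (zid V - (zcomp w u : zhom V V)) 0.
  exact: zero_defect_iso uwu p0.
have [u' u'u] := larger_rank charE uwu p0.
by apply: (IH u'); apply: leq_trans u'u _.
Qed.
End Averaging.

(** * Twisting by an automorphism *)

Section CharacterValues.
Variables (k : fieldType) (gT : finGroupType).
Implicit Types V U W : zobj k gT.
Local Open Scope lfun_scope.

Lemma zpi_unique V (p : gT -> 'End(V)) :
  (forall g h v, v \in zgr V h -> p g v = if g == h then v else 0) ->
  forall g, zpi V g = p g.
Proof. by move=> pP g; apply/zhom_ext => h v vh;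
  rewrite (pP g h) // (zpi_hom _ vh). Qed.

Lemma zact_zpi_comp V g f :
  zact V g \o zpi V f = zpi V (g * f * g^-1)%g \o zact V g.
Proof.
apply/zhom_ext => h v vh; rewrite !comp_lfunE (zpi_hom _ vh).
rewrite (zpi_hom _ (zact_mem g vh)) (inj_eq (mulIg _)) (inj_eq (mulgI _)).
by case: eqP => // _; rewrite linear0.
Qed.

Lemma zpi_idem V f : zpi V f \o zpi V f = zpi V f.
Proof. by apply/lfunP => v; rewrite comp_lfunE zpiK eqxx. Qed.

Lemma zchar_conj V t g f :
  zchar V (t * g * t^-1)%g (t * f * t^-1)%g = zchar V g f.
Proof.
rewrite /zchar !zactM -!comp_lfunA ltrace_comp.
have := zact_zpi_comp V t^-1%g (t * f * t^-1)%g.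
rewrite invgK !mulgA mulVg mul1g mulgKV => ->.
by rewrite -!comp_lfunA -zactM mulVg zact1 comp_lfun1r.
Qed.

(** [g] carries [V_f] into a different homogeneous component, so its diagonal block on [V_f] is
    zero. *)
Lemma zchar_noncommuting V g f : (g * f)%g != (f * g)%g -> zchar V g f = 0.
Proof.
move=> gf; rewrite /zchar -zpi_idem comp_lfunA ltrace_comp zact_zpi_comp comp_lfunA.
have -> : zpi V f \o zpi V (g * f * g^-1)%g = 0.
  apply/lfunP => v; rewrite comp_lfunE zpiK zero_lfunE; case: eqP => // e.
  by case/eqP: gf; rewrite {2}e mulgKV.
by rewrite comp_lfun0l linear0.
Qed.

(** Projecting a form to degree [f] and then acting by [g] is precomposition with
    [zpi V f^-1 \o zact V g^-1], a sandwich whose left factor is the identity of [k^o]. *)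
Lemma zchar_dual V g f : zchar (zdual V) g f = zchar V g^-1%g f^-1%g.
Proof.
rewrite /zchar [RHS]ltrace_comp.
pose pi' h := precomp (zpi V h^-1%g).
rewrite (@zpi_unique (zdual V) pi') => [|a b l /mem_zdual_gr lb]; last first.
  apply/zhom_ext => c v vc; rewrite precompE (zpi_hom _ vc).
  have [->|ab] := eqVneq a b.
    case: (_ =P c) => // bc; rewrite linear0 (lb c v _ vc) //.
    by apply/eqP => e; case: bc.
  case: eqP => [ac|_]; last by rewrite linear0 zero_lfunE.
  rewrite zero_lfunE (lb c v _ vc) //.
  by rewrite -ac (inj_eq invg_inj).
rewrite (@ltrace_sandwich k V k^o \1 (zpi V f^-1%g \o zact V g^-1%g)) => [|l].
  have -> : ltrace (\1 : 'End(k^o)) = 1 by rewrite ltrace1 dimvf.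
  by rewrite mul1r.
rewrite comp_lfun1l; apply/lfunP => v.
rewrite comp_lfunE [LHS]precompE precompE -comp_lfunE.
by rewrite [RHS]comp_lfunE.
Qed.
End CharacterValues.

Section Twist.
Variables (k : fieldType) (gT : finGroupType).
Implicit Types V U W : zobj k gT.
Local Open Scope lfun_scope.

Section Objects.
Variables (psi : {perm gT}) (psiM : {morph psi : x y / (x * y)%g}).

Lemma perm_morph1 : psi 1%g = 1%g.
Proof. by apply: (mulgI (psi 1%g)); rewrite -psiM !mulg1. Qed.

Lemma perm_morphV x : psi x^-1%g = (psi x)^-1%g.
Proof. by apply: (mulgI (psi x)); rewrite -psiM !mulgV perm_morph1. Qed.

Fact twist_full V : (\sum_g zgr V (psi g))%VS = fullv.
Proof. by rewrite -(zgr_full V) [RHS](reindex_inj (@perm_inj _ psi)). Qed.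

Fact twist_direct V : direct_family (fun g => zgr V (psi g)).
Proof.
apply: (@direct_of_pi _ _ _ _ (fun g => zpi V (psi g))) => g h v vh.
by rewrite (zpi_hom _ vh) (inj_eq perm_inj).
Qed.

(** The underlying space is unchanged, so the structure maps of the twisting functor are identity
    maps and only their compatibility with degrees and actions needs checking. *)
Definition twist V : zobj k gT.
Proof.
apply: (@ZObj k gT V (fun g => zgr V (psi g)) (fun g => zact V (psi g))
  (twist_full V) (twist_direct V)).
- by rewrite perm_morph1 zact1.
- by move=> f g; rewrite psiM zactM.
- by move=> f g; rewrite zact_gr !psiM perm_morphV.
Defined.

Lemma zchar_twist V g f : zchar (twist V) g f = zchar V (psi g) (psi f).
Proof.
rewrite /zchar; congr (ltrace (_ \o _)).
rewrite (@zpi_unique _ _ (twist V) (fun g => zpi V (psi g))) // => a b v vb.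
by rewrite (@zpi_hom _ _ V _ (psi b) _ vb) (inj_eq perm_inj).
Qed.

Lemma twist_hom_subproof V U (f : zhom V U) :
  (f : 'Hom(V, U)) \in @zhom_pred k gT (twist V) (twist U).
Proof. by apply/zhom_predP; split=> g v;
  [exact: (@zhom_gr _ _ V U f (psi g)) | exact: (@zhom_act _ _ V U f (psi g))]. Qed.

Definition twist_hom V U (f : zhom V U) : zhom (twist V) (twist U) :=
  ZHom (twist_hom_subproof f).

Definition twist_lin : linFunctor (centre_lin k gT) (centre_lin k gT).
Proof.
apply: (@LinFunctor k (centre_lin k gT) (centre_lin k gT) twist twist_hom).
- by move=> V U a f g; apply: zhom_eq.
- by move=> V; apply: zhom_eq.
- by move=> V U W g f; apply: zhom_eq.
Defined.

Lemma twist_tens_subproof V U :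
  \1 \in @zhom_pred k gT (ztens (twist V) (twist U)) (twist (ztens V U)).
Proof.
apply: zhom_pred_tens => [a b v u va ub|g v u]; rewrite !id_lfunE.
  by rewrite /= psiM mem_ztens_gr.
by rewrite [RHS]zact_tens.
Qed.

Definition twist_tens V U :
  zhom (ztens (twist V) (twist U)) (twist (ztens V U)) :=
  ZHom (twist_tens_subproof V U).

Lemma twist_unit_subproof : \1 \in @zhom_pred k gT (zunit k gT) (twist (zunit k
  gT)).
Proof.
apply/zhom_predP; split=> g v; rewrite !id_lfunE //=.
by rewrite /zunit_gr -{2}perm_morph1 (inj_eq perm_inj).
Qed.

Definition twist_unit : zhom (zunit k gT) (twist (zunit k gT)) :=
  ZHom twist_unit_subproof.

Lemma is_iso_id V U (f : zhom V U) (g : 'Hom(U, V)) :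
  g \o f = \1 -> f \o g = \1 -> @is_iso k (centre_lin k gT) V U f.
Proof.
move=> gf fg; apply: (@centre_iso _ _ _ _ f g) => x.
  by rewrite -comp_lfunE gf id_lfunE.
by rewrite -comp_lfunE fg id_lfunE.
Qed.

Definition twist_mon : monFunctor (centre_mon k gT) (centre_mon k gT).
Proof.
apply: (@MonFunctor k (centre_mon k gT) (centre_mon k gT) twist_lin twist_tens
  twist_unit).
- by move=> V U; apply: (@is_iso_id _ _ (twist_tens V U) \1); rewrite comp_lfun1l.
- by apply: (@is_iso_id _ _ twist_unit \1); rewrite comp_lfun1l.
- move=> V V' U U' f g; apply: zhom_eq; apply: tens_ext => v u /=.
  by rewrite comp_lfun1l comp_lfun1r.
- move=> V U W; apply: zhom_eq; apply: tens_ext3l => v u w /=.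
  by rewrite !comp_lfun1l !comp_lfunE !tmapE !id_lfunE tassocE tmapE !id_lfunE.
- move=> V; apply: zhom_eq; apply: tens_ext => v u /=.
  by rewrite !comp_lfunE !tmapE !id_lfunE.
- move=> V; apply: zhom_eq; apply: tens_ext => v u /=.
  by rewrite !comp_lfunE !tmapE !id_lfunE.
Defined.

Definition twist_braided : braidedFunctor (drinfeld_centre k gT)
  (drinfeld_centre k gT).
Proof.
apply: (@BraidedFunctor k (drinfeld_centre k gT) (drinfeld_centre k gT) twist_mon).
move=> V U; apply: zhom_eq; apply: ztens_ext => a v u va /=.
rewrite comp_lfun1l comp_lfun1r (@tbraidE _ _ (twist V) (twist U) _ _ _ va).
by rewrite (@tbraidE _ _ V U _ _ _ va).
Defined.
End Objects.

Section Inverse.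
Variables (psi phi : {perm gT}).
Hypotheses (psiM : {morph psi : x y / (x * y)%g})
  (phiM : {morph phi : x y / (x * y)%g}) (phiK : cancel phi psi).

Lemma untwist_subproof V :
  \1 \in @zhom_pred k gT (twist phiM (twist psiM V)) V.
Proof. by apply/zhom_predP; split=> g v; rewrite !id_lfunE /= phiK. Qed.

Definition untwist V : zhom (twist phiM (twist psiM V)) V :=
  ZHom (untwist_subproof V).

Lemma untwist_iso V :
  @is_iso k (centre_lin k gT) (twist phiM (twist psiM V)) V (untwist V).
Proof.
by apply: (@is_iso_id (twist phiM (twist psiM V)) V (untwist V) \1);
  rewrite /= comp_lfun1l.
Qed.

Lemma twist_twist_iso :
  naturally_isomorphic (comp_functor (twist_lin phiM) (twist_lin psiM))
    (id_functor (centre_lin k gT)).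
Proof.
exists untwist; split=> [V|V U f]; first exact: untwist_iso.
by apply: zhom_eq; rewrite /= comp_lfun1l comp_lfun1r.
Qed.
End Inverse.

Lemma twist_equivalence (psi phi : {perm gT})
    (psiM : {morph psi : x y / (x * y)%g}) (phiM : {morph phi : x y / (x * y)%g}) :
  cancel psi phi -> cancel phi psi -> is_equivalence (twist_braided psiM).
Proof.
by move=> psiK phiK; exists (twist_lin phiM); split; exact: twist_twist_iso.
Qed.

(** Characters are compared. For commuting [g] and [f], double class inversion at the pair [psi g],
    [psi f] conjugates the pair [g^-1], [f^-1] to it; for other pairs both characters vanish. *)
Lemma twist_dualising (psi phi : {perm gT}) (psiM : {morph psi : x y / (x * y)%g}) :
  [pchar k] =i pred0 -> cancel psi phi -> double_class_inverting phi ->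
  dualising (twist_braided psiM).
Proof.
move=> hk psiK dci V; apply: (char_isomorphic hk (V := twist psiM V)) => g f.
rewrite zchar_twist zchar_dual.
have [gf|gf] := eqVneq (g * f)%g (f * g)%g; last first.
  rewrite !zchar_noncommuting //.
    by rewrite -!invMg (inj_eq invg_inj) eq_sym.
  by rewrite -!psiM (inj_eq perm_inj).
have [h []] : exists h : gT, phi (psi g) = (h * (psi g)^-1 * h^-1)%g /\
    phi (psi f) = (h * (psi f)^-1 * h^-1)%g.
  by apply: dci; rewrite /commute -!psiM gf.
rewrite !psiK => eg ef; rewrite [in RHS]eg [in RHS]ef.
by rewrite !invMg !invgK !mulgA zchar_conj.
Qed.
End Twist.

(** * Induced objects *)

Section InducedObjects.
Variables (k : fieldType) (gT : finGroupType).
Implicit Types V U W : zobj k gT.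
Local Open Scope lfun_scope.

Notation fnv := ({ffun gT -> k^o} : vectType k).

(** The indicator of [s] stands for [s] applied to a generator of degree [f], so its degree is
    [s * f * s^-1]. *)
Definition supp_proj (f d : gT) : 'End(fnv) :=
  linfun (fun x : fnv => [ffun s => if (s * f * s^-1 == d)%g then x s else 0] :
    fnv).

Lemma supp_projE f d (x : fnv) s :
  supp_proj f d x s = if (s * f * s^-1 == d)%g then x s else 0.
Proof.
rewrite linear_lfunE ?ffunE // => a y z; apply/ffunP => t; rewrite !ffunE.
by case: eqP => // _; rewrite scaler0 addr0.
Qed.

Definition left_transl (h : gT) : 'End(fnv) :=
  linfun (fun x : fnv => [ffun s => x (h^-1 * s)%g] : fnv).

Lemma left_translE h (x : fnv) s : left_transl h x s = x (h^-1 * s)%g.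
Proof.
by rewrite linear_lfunE ?ffunE // => a y z; apply/ffunP => t; rewrite !ffunE.
Qed.

(** With this convention the indicator of [s] goes to that of [s * h], and composition reverses the
    order of products. *)
Definition right_transl (h : gT) : 'End(fnv) :=
  linfun (fun x : fnv => [ffun s => x (s * h^-1)%g] : fnv).

Lemma right_translE h (x : fnv) s : right_transl h x s = x (s * h^-1)%g.
Proof.
by rewrite linear_lfunE ?ffunE // => a y z; apply/ffunP => t; rewrite !ffunE.
Qed.

Definition delta (s : gT) : fnv := [ffun t => (t == s)%:R].

Lemma delta_sum (x : fnv) : x = \sum_s (x s : k) *: delta s.
Proof.
apply/ffunP => t; rewrite sum_ffunE (bigD1 t) //= !ffunE eqxx big1 => [|s st].
  by rewrite addr0 -[RHS]/(_ * _) mulr1.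
by rewrite !ffunE eq_sym (negPf st) scaler0.
Qed.

Section Object.
Variable f : gT.

Definition ind_gr (d : gT) : {vspace fnv} := limg (supp_proj f d).

Lemma ind_grP d (x : fnv) :
  reflect (forall s, (s * f * s^-1 != d)%g -> x s = 0) (x \in ind_gr d).
Proof.
apply: (iffP memv_imgP) => [[y _ ->] s /negPf sd|xd].
  by rewrite supp_projE sd.
exists x; first exact: memvf.
apply/ffunP => s; rewrite supp_projE.
by case: eqP => // /eqP/xd.
Qed.

Fact ind_full : (\sum_d ind_gr d)%VS = fullv.
Proof.
apply: full_of_mem => x; have -> : x = \sum_d supp_proj f d x.
  apply/ffunP => s; rewrite sum_ffunE (bigD1 (s * f * s^-1)%g) //= big1.
    by rewrite supp_projE eqxx addr0.
  by move=> d /negPf ds; rewrite supp_projE eq_sym ds.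
rewrite rpred_sum // => d _.
by apply: (subvP (sumv_sup d _ (subvv _))) => //; rewrite memv_img ?memvf.
Qed.

Lemma supp_proj_hom g h (x : fnv) :
  x \in ind_gr h -> supp_proj f g x = if g == h then x else 0.
Proof.
move/ind_grP => xh; apply/ffunP => s; rewrite supp_projE.
have [->|gh] := eqVneq g h; first by case: eqP => // /eqP/xh.
by rewrite ffunE; case: eqP => // sg; rewrite xh // sg.
Qed.

Fact ind_direct : direct_family ind_gr.
Proof. exact: direct_of_pi supp_proj_hom. Qed.

Fact left_transl1 : left_transl 1%g = \1.
Proof. by apply/lfunP => x; apply/ffunP => s;
  rewrite left_translE id_lfunE invg1 mul1g. Qed.

Fact left_translM g h : left_transl (g * h)%g = left_transl g \o left_transl h.
Proof.
by apply/lfunP => x; apply/ffunP => s; rewrite comp_lfunE !left_translE invMg mulgA.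
Qed.

Fact left_transl_gr h d :
  (left_transl h @: ind_gr d <= ind_gr (h * d * h^-1)%g)%VS.
Proof.
apply/subvP => _ /memv_imgP[x /ind_grP xd ->]; apply/ind_grP => s sd.
rewrite left_translE xd //; apply: contra sd => /eqP <-.
by rewrite invMg invgK !mulgA mulgV mul1g mulgK.
Qed.

Definition ind_obj : zobj k gT :=
  ZObj ind_full ind_direct left_transl1 left_translM
    (act_gr_of_sub left_transl1 left_translM left_transl_gr).

Lemma zpi_ind d : zpi ind_obj d = supp_proj f d.
Proof. exact: (@zpi_unique k gT ind_obj _ supp_proj_hom). Qed.

Lemma mem_delta s : delta s \in zgr ind_obj (s * f * s^-1)%g.
Proof.
apply/ind_grP => t; rewrite ffunE; have [->|//] := eqVneq t s.
by rewrite eqxx.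
Qed.

Lemma right_transl_subproof h :
  commute h f -> right_transl h \in @zhom_pred k gT ind_obj ind_obj.
Proof.
move=> hf; apply/zhom_predP; split=> [d x /ind_grP xd|d x].
  apply/ind_grP => s sd; rewrite right_translE xd //.
  apply: contra sd => /eqP <-; apply/eqP.
  rewrite invMg invgK !mulgA; congr (_ * _)%g; rewrite -!mulgA; congr (_ * _)%g.
  by apply: (mulgI h); rewrite mulKVg.
apply/ffunP => s.
by rewrite right_translE !left_translE right_translE mulgA.
Qed.

Definition ind_transl h (hf : commute h f) : zhom ind_obj ind_obj :=
  ZHom (right_transl_subproof hf).

(* Frobenius reciprocity: [V_f = Hom(ind_obj f, V)]. *)
Definition ind_map V (v : V) : 'Hom(ind_obj, V) :=
  linfun (fun x : fnv => \sum_s (x s : k) *: zact V s (zpi V f v)).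

Lemma ind_mapE V (v : V) (x : fnv) :
  ind_map v x = \sum_s (x s : k) *: zact V s (zpi V f v).
Proof.
rewrite linear_lfunE // => a y z; rewrite scaler_sumr -big_split.
by apply: eq_bigr => s _; rewrite /= !ffunE scalerDl scalerA.
Qed.

Lemma ind_map_subproof V (v : V) : ind_map v \in @zhom_pred k gT ind_obj V.
Proof.
apply/zhom_predP; split=> [d x /ind_grP xd|h x]; rewrite !ind_mapE.
  apply: rpred_sum => s _; have [<-|/xd->] := eqVneq (s * f * s^-1)%g d.
    by rewrite rpredZ // zact_mem ?zpi_mem.
  by rewrite scale0r mem0v.
rewrite linear_sum (reindex_inj (mulgI h)); apply: eq_bigr => s _ /=.
by rewrite linearZ left_translE mulKg zactM comp_lfunE.
Qed.

Definition ind_hom V (v : V) : zhom ind_obj V := ZHom (ind_map_subproof v).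

Lemma ind_hom_linear V : linear (@ind_hom V).
Proof.
move=> a v w; apply: zhom_eq; apply/lfunP => x.
rewrite /= add_lfunE scale_lfunE !ind_mapE scaler_sumr -big_split.
by apply: eq_bigr => s _; rewrite /= !linearP.
Qed.

Lemma ind_hom_delta V (v : V) : ind_hom v (delta 1%g) = zpi V f v.
Proof.
rewrite ind_mapE (bigD1 1%g) //= big1 => [|s /negPf s1]; rewrite ffunE.
  by rewrite eqxx scale1r addr0 zact1 id_lfunE.
by rewrite s1 scale0r.
Qed.

(** Through Frobenius reciprocity the action of the centraliser on [V_f] becomes precomposition with
    translations, a form that any functor transports. *)
Lemma ind_hom_transl V (v : V) h (hf : commute h f) :
  zcomp (ind_hom v) (ind_transl hf) = ind_hom (zact V h v).
Proof.
apply: zhom_eq; apply/lfunP => x; rewrite comp_lfunE !ind_mapE.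
rewrite (reindex_inj (mulIg h)) /=; apply: eq_bigr => s _.
rewrite right_translE mulgK zactM comp_lfunE; congr (_ *: zact V s _).
by rewrite -!comp_lfunE zact_zpi_comp hf mulgK.
Qed.
End Object.

Lemma ind1_trivial (x : fnv) : x \in zgr (ind_obj 1%g) 1%g.
Proof. by apply/ind_grP => s; rewrite mulg1 mulgV eqxx. Qed.

Section Multiplication.
Variable f : gT.

Definition ind_mul_lfun : 'Hom(tensv fnv fnv, fnv) :=
  tlift (fun a x : fnv => [ffun s => (a s * x s : k)] : fnv).

Lemma ind_mul_lfunE (a x : fnv) s : ind_mul_lfun (a *t x) s = (a s : k) * x s.
Proof.
rewrite tliftE ?ffunE // => [y|y] c z w; apply/ffunP => t; rewrite !ffunE.
  by rewrite mulrDl -scalerAl.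
by rewrite mulrDr -scalerAr.
Qed.

Lemma ind_mul_subproof :
  ind_mul_lfun \in @zhom_pred k gT (ztens (ind_obj 1%g) (ind_obj f)) (ind_obj f).
Proof.
apply: zhom_pred_tens => [a b v u /ind_grP va /ind_grP ub|g v u].
  apply/ind_grP => s sab; rewrite ind_mul_lfunE.
  have [a1|a1] := eqVneq a 1%g.
    by rewrite ub ?mulr0 //; move: sab; rewrite a1 mul1g.
  by rewrite va ?mul0r // mulg1 mulgV eq_sym.
by apply/ffunP => s; rewrite ind_mul_lfunE !left_translE ind_mul_lfunE.
Qed.

Definition ind_mul : zhom (ztens (ind_obj 1%g) (ind_obj f)) (ind_obj f) :=
  ZHom ind_mul_subproof.
End Multiplication.

Definition ind_one_lfun : 'Hom(k^o, fnv) :=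
  linfun (fun c : k^o => [ffun => c] : fnv).

Lemma ind_one_lfunE c s : ind_one_lfun c s = c.
Proof. by rewrite linear_lfunE ?ffunE // => a x y; apply/ffunP => t;
  rewrite !ffunE. Qed.

Lemma ind_one_subproof : ind_one_lfun \in @zhom_pred k gT (zunit k gT) (ind_obj
  1%g).
Proof.
apply/zhom_predP; split=> [d c|g c].
  rewrite /= /zunit_gr; case: eqP => [->|_]; first by rewrite ind1_trivial.
  by rewrite memv0 => /eqP ->; rewrite linear0 mem0v.
by apply/ffunP => s; rewrite left_translE !ind_one_lfunE id_lfunE.
Qed.

Definition ind_one : zhom (zunit k gT) (ind_obj 1%g) := ZHom ind_one_subproof.

Lemma ind_mul_assoc f :
  zcomp (zcomp (ind_mul f) (ztensm (zid _) (ind_mul f))) (zassoc _ _ _) =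
  zcomp (ind_mul f) (ztensm (ind_mul 1%g) (zid _)).
Proof.
apply: zhom_eq; apply: tens_ext3l => a b x /=.
rewrite !comp_lfunE tassocE !tmapE !id_lfunE; apply/ffunP => s.
by rewrite !ind_mul_lfunE mulrA.
Qed.

Lemma ind_mul_unit f : zcomp (ind_mul f) (ztensm ind_one (zid _)) = zlunit _.
Proof.
apply: zhom_eq; apply: tens_ext => c x /=.
rewrite !comp_lfunE tmapE tlunitE id_lfunE; apply/ffunP => s.
by rewrite ind_mul_lfunE ind_one_lfunE ffunE.
Qed.

Lemma ind_mul_braid : zcomp (ind_mul 1%g) (zbraid _ _) = ind_mul 1%g.
Proof.
apply: zhom_eq; apply: tens_ext => a b /=.
rewrite comp_lfunE (@tbraidE _ _ (ind_obj 1%g) (ind_obj 1%g) _ _ _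
  (ind1_trivial a)) zact1 id_lfunE.
by apply/ffunP => s; rewrite !ind_mul_lfunE mulrC.
Qed.

(** The first braiding is a flip, as [A] has degree 1. In the second, the indicator of [s], of
    degree [s * f * s^-1], translates [a] on the left by that degree; at the point [s] this amounts
    to right translation by [f]. *)
Lemma ind_mul_monodromy f :
  zcomp (zcomp (ind_mul f) (zbraid _ _)) (zbraid _ _) =
  zcomp (ind_mul f) (ztensm (ind_transl (commute1 f)) (zid _)).
Proof.
apply: zhom_eq; apply: tens_ext => a x /=.
rewrite !comp_lfunE (@tbraidE _ _ (ind_obj 1%g) (ind_obj f) _ _ _ (ind1_trivial a)).
rewrite zact1 id_lfunE tmapE id_lfunE [x]delta_sum tens_suml !tens_sumr !linear_sum.
apply: eq_bigr => s _; rewrite tensZl !tensZr !linearZ; congr (_ *: _) => /=.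
rewrite (@tbraidE _ _ (ind_obj f) (ind_obj 1%g) _ _ _ (mem_delta f s)).
apply/ffunP => t; rewrite !ind_mul_lfunE left_translE right_translE ffunE.
case: eqP => [->|_]; last by rewrite !mulr0.
by rewrite !invMg !invgK -!mulgA mulVg mulg1.
Qed.

Lemma ind_transl_mul f h (hf : commute h f) :
  zcomp (ind_transl hf) (ind_mul f) =
  zcomp (ind_mul f) (ztensm (ind_transl (commute1 h)) (ind_transl hf)).
Proof.
apply: zhom_eq; apply: tens_ext => a x /=.
rewrite !comp_lfunE tmapE; apply/ffunP => s.
by rewrite !(right_translE, ind_mul_lfunE).
Qed.
Lemma right_transl_delta h s : right_transl h (delta s) = delta (s * h)%g.
Proof.
apply/ffunP => t; rewrite right_translE !ffunE.
by rewrite (canF_eq (mulgKV h)).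
Qed.

Lemma left_transl_delta h s : left_transl h (delta s) = delta (h * s)%g.
Proof.
apply/ffunP => t; rewrite left_translE !ffunE.
by rewrite (canF_eq (mulKVg h)).
Qed.

Lemma delta_inj : injective delta.
Proof.
move=> s t /ffunP/(_ s); rewrite !ffunE eqxx.
by case: eqP => // _ /eqP; rewrite oner_eq0.
Qed.

End InducedObjects.

(** * The image of the algebra of functions *)

Section Equivalences.
Variables (k : nzRingType) (C D : linCat k) (F : linFunctor C D).
Hypothesis Fequiv : is_equivalence F.

Local Open Scope cat_scope.

Lemma equivalence_counits : exists (G : linFunctor D C)
    (eta : forall X, Defs.hom (G (F X)) X) (eps : forall Y, Defs.hom (F (G Y)) Y),
  [/\ forall X, is_iso (eta X),
      forall X Y (f : Defs.hom X Y), eta Y \oc fmor G (fmor F f) = f \oc eta X,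
      forall Y, is_iso (eps Y) &
      forall X Y (f : Defs.hom X Y), eps Y \oc fmor F (fmor G f) = f \oc eps X].
Proof.
have [G [[eta [eta_iso eta_nat]] [eps [eps_iso eps_nat]]]] := Fequiv.
by exists G, eta, eps.
Qed.

Lemma equivalence_faithful (X Y : obj C) : injective (@fmor _ _ _ F X Y).
Proof.
have [G [eta [_ [etaP eN _ _]]]] := equivalence_counits.
move=> f g fg; have [i [_ eK]] := etaP X.
by rewrite -[f]compm1 -[g]compm1 -eK !compmA -!eN fg.
Qed.

Lemma equivalence_full (X Y : obj C) (f : Defs.hom (F X) (F Y)) :
  exists g : Defs.hom X Y, fmor F g = f.
Proof.
have [G [eta [eps [etaP eN epsP pN]]]] := equivalence_counits.
have [i [iK _]] := etaP X; have [j [jK _]] := etaP Y; have [l [_ pK]] := epsP (F X).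
pose g := eta Y \oc fmor G f \oc i; exists g.
have Gg : fmor G (fmor F g) = fmor G f.
  rewrite -[LHS]comp1m -jK -compmA eN /g -!compmA iK compm1.
  by rewrite compmA jK comp1m.
by rewrite -[fmor F g]compm1 -[f]compm1 -pK !compmA -!pN Gg.
Qed.
End Equivalences.

Section UnfoldedFunctor.
Variables (k : fieldType) (gT : finGroupType).
Implicit Types V U W : zobj k gT.
Local Open Scope lfun_scope.

(* A dualising braided autoequivalence with the category structures unfolded:
   keeping its data abstract makes conversion problems about [F V] cheap. *)
Record dual_autoeq := DualAutoeq {
  aobj : zobj k gT -> zobj k gT;
  ahom : forall V U, zhom V U -> zhom (aobj V) (aobj U);
  atens : forall V U, zhom (ztens (aobj V) (aobj U)) (aobj (ztens V U));
  aunit : zhom (zunit k gT) (aobj (zunit k gT));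
  ahom_linear : forall V U, linear (@ahom V U);
  ahom_comp : forall V U W (g : zhom U W) (f : zhom V U),
    ahom (zcomp g f) = zcomp (ahom g) (ahom f);
  ahom1 : forall V, ahom (zid V) = zid (aobj V);
  ahom_inj : forall V U, injective (@ahom V U);
  ahom_surj : forall V U (f : zhom (aobj V) (aobj U)), exists g, ahom g = f;
  atens_nat : forall V V' U U' (f : zhom V V') (g : zhom U U'),
    zcomp (atens V' U') (ztensm (ahom f) (ahom g)) =
    zcomp (ahom (ztensm f g)) (atens V U);
  atens_assoc : forall V U W,
    zcomp (zcomp (ahom (zassoc V U W)) (atens (ztens V U) W))
      (ztensm (atens V U) (zid _)) =
    zcomp (zcomp (atens V (ztens U W)) (ztensm (zid _) (atens U W)))
      (zassoc _ _ _);
  atens_unit : forall V,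
    zcomp (zcomp (ahom (zlunit V)) (atens (zunit k gT) V))
      (ztensm aunit (zid _)) = zlunit (aobj V);
  atens_braid : forall V U,
    zcomp (ahom (zbraid V U)) (atens V U) =
    zcomp (atens U V) (zbraid (aobj V) (aobj U));
  atensV : forall V U, exists g, zcomp (atens V U) g = zid _;
  aobj_dual : forall V, exists (u : zhom (aobj V) (zdual V)) (w : zhom _ _),
    zcomp w u = zid _ /\ zcomp u w = zid _
}.

Section Unfold.
Variable F : braidedFunctor (drinfeld_centre k gT) (drinfeld_centre k gT).
Hypothesis Fequiv : is_equivalence F.
Hypothesis Fdual : dualising F.

Definition unfold_functor : dual_autoeq.
Proof.
apply: (@DualAutoeq (fobj F) (@fmor _ _ _ F) (@fmon _ _ _ F) (fmon0 F)).
- exact: (@fmor_linear _ _ _ F).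
- exact: (@fmor_comp _ _ _ F).
- exact: (@fmor1 _ _ _ F).
- exact: (equivalence_faithful Fequiv).
- exact: (equivalence_full Fequiv).
- exact: (@fmon_nat _ _ _ F).
- exact: (@fmon_assoc _ _ _ F).
- exact: (@fmon_lunit _ _ _ F).
- exact: (@fmon_braid _ _ _ F).
- by move=> V U; have [g [_ e]] := @fmon_iso _ _ _ F V U; exists g; exact: e.
- by move=> V; have [u [w uw]] := Fdual V; exists u, w; exact: uw.
Qed.
End Unfold.
End UnfoldedFunctor.

Lemma dim_cancel (k : fieldType) (V U : vectType k) (u : 'Hom(V, U)) (w :
  'Hom(U, V)) :
  cancel u w -> cancel w u -> \dim {:V} = \dim {:U}.
Proof.
move=> uK wK; have k0 : (fullv :&: lker u)%VS = 0%VS.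
  by apply/eqP; rewrite capfv; apply/lker0P; exact: can_inj uK.
rewrite -(limg_dim_eq k0); congr (\dim _).
by apply/eqP; rewrite eqEsubv subvf; apply/subvP => x _;
  rewrite -[x]wK memv_img ?memvf.
Qed.

Lemma cancel_dim (k : fieldType) (V U : vectType k) (u : 'Hom(V, U)) (w :
  'Hom(U, V)) :
  \dim {:V} = \dim {:U} -> cancel u w -> cancel w u.
Proof.
move=> dimE uK; have k0 : (fullv :&: lker u)%VS = 0%VS.
  by apply/eqP; rewrite capfv; apply/lker0P; exact: can_inj uK.
have full : limg u = fullv.
  by apply/eqP; rewrite eqEdim subvf -dimE (limg_dim_eq k0) leqnn.
by move=> x; have := memvf x; rewrite -full => /memv_imgP[y _ ->]; rewrite uK.
Qed.

Section AlgebraImage.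
Variables (k : fieldType) (gT : finGroupType) (F : dual_autoeq k gT).
Implicit Types V U W : zobj k gT.
Local Open Scope lfun_scope.

Lemma zhomE V U (f g : zhom V U) : f = g -> forall x, f x = g x.
Proof. by move=> ->. Qed.

Lemma zcompE V U W (g : zhom U W) (f : zhom V U) x : zcomp g f x = g (f x).
Proof. exact: comp_lfunE. Qed.

Lemma zidE V x : zid V x = x.
Proof. exact: id_lfunE. Qed.

Lemma ztensmE V V' U U' (f : zhom V V') (g : zhom U U') x y :
  ztensm f g (x *t y) = f x *t g y.
Proof. exact: tmapE. Qed.

Lemma zassocE V U W x y z : zassoc V U W (x *t y *t z) = x *t (y *t z).
Proof. exact: tassocE. Qed.

Lemma ahom_compE V U W (g : zhom U W) (f : zhom V U) x :
  ahom F (zcomp g f) x = ahom F g (ahom F f x).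
Proof. by rewrite ahom_comp zcompE. Qed.

Lemma ahom1E V x : ahom F (zid V) x = x.
Proof. by rewrite ahom1 zidE. Qed.

Lemma ahom0 V U : ahom F (0 : zhom V U) = 0.
Proof.
have := ahom_linear F (-1) (0 : zhom V U) 0.
by rewrite scaler0 addr0 scaleN1r addNr.
Qed.

Lemma atens_natE V V' U U' (f : zhom V V') (g : zhom U U') x y :
  atens F V' U' (ahom F f x *t ahom F g y) =
  ahom F (ztensm f g) (atens F V U (x *t y)).
Proof.
have /zhomE/(_ (x *t y)) := atens_nat F f g.
by rewrite !zcompE ztensmE.
Qed.

Lemma atens_assocE V U W x y z :
  ahom F (zassoc V U W) (atens F (ztens V U) W (atens F V U (x *t y) *t z)) =
  atens F V (ztens U W) (x *t atens F U W (y *t z)).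
Proof.
have /zhomE/(_ (x *t y *t z)) := atens_assoc F V U W.
by rewrite !zcompE zassocE !ztensmE !zidE.
Qed.

Lemma atens_unitE V c x :
  ahom F (zlunit V) (atens F (zunit k gT) V (aunit F c *t x)) = (c : k) *: x.
Proof.
have /zhomE/(_ (c *t x)) := atens_unit F V.
by rewrite !zcompE ztensmE zidE => ->; exact: tlunitE.
Qed.

Lemma atens_braidE V U m :
  ahom F (zbraid V U) (atens F V U m) = atens F U V (zbraid (aobj F V) (aobj F
    U) m).
Proof. by have /zhomE/(_ m) := atens_braid F V U; rewrite !zcompE. Qed.

Notation A := (ind_obj k (1%g : gT)).
Notation E := (ind_obj k).

(** For [f = 1] this is the product of the algebra [F A]; for general [f] it is the action of that
    algebra on [F E_f]. *)
Definition amul f (a : aobj F A) (x : aobj F (E f)) : aobj F (E f) :=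
  ahom F (ind_mul k f) (atens F A (E f) (a *t x)).

Definition aone : aobj F A := ahom F (ind_one k gT) (aunit F (1 : k^o)).

Lemma amul_linear_l f x : linear (fun a => @amul f a x).
Proof. by move=> c a b; rewrite /amul tens_linear_l !linearP. Qed.

Lemma amul_linear_r f a : linear (@amul f a).
Proof. by move=> c x y; rewrite /amul tens_linear_r !linearP. Qed.

Lemma amulA f a b x : amul (amul a b) x = amul a (amul b x) :> aobj F (E f).
Proof.
rewrite /amul -{1}[x]ahom1E -{2}[a]ahom1E !atens_natE -!ahom_compE.
by rewrite -ind_mul_assoc ahom_compE atens_assocE.
Qed.

Lemma amul1 f x : amul aone x = x :> aobj F (E f).
Proof.
by rewrite /amul /aone -{1}[x]ahom1E atens_natE -ahom_compE ind_mul_unit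
  atens_unitE scale1r.
Qed.

Lemma amul_act f g a x :
  zact (aobj F (E f)) g (amul a x) = amul (zact _ g a) (zact _ g x).
Proof. by rewrite /amul -!zhom_act zact_tens. Qed.

Lemma amul_transl f h (hf : commute h f) a x :
  ahom F (ind_transl k hf) (amul a x) =
  amul (ahom F (ind_transl k (commute1 h)) a) (ahom F (ind_transl k hf) x).
Proof. by rewrite /amul atens_natE -!ahom_compE ind_transl_mul. Qed.

(** [F A] is isomorphic to the dual of [A], and [A] lives in degree 1 only. *)
Lemma aobj_trivial (a : aobj F A) : a \in zgr (aobj F A) 1%g.
Proof.
have [u [w [/zhomE wu _]]] := aobj_dual F A.
rewrite -[a]zidE -wu zcompE; apply: zhom_gr; apply/mem_zdual_gr => h v h1 vh.
suff -> : v = 0 by rewrite linear0.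
have := zpi_hom 1%g vh; rewrite (zpi_hom _ (ind1_trivial v)) eqxx.
by rewrite eq_sym -[X in (h == X)%g]invg1 (negPf h1).
Qed.

Lemma amulC a b : amul a b = amul b a :> aobj F A.
Proof.
rewrite /amul -{1}ind_mul_braid ahom_compE atens_braidE.
by rewrite [zbraid _ _ _](tbraidE _ (aobj_trivial a)) zact1 id_lfunE.
Qed.

(** This is [ind_mul_monodromy] carried through [F], with the double braiding evaluated in the
    target: a flip, since [F A] has degree 1, followed by the action of the degree [d] of [x] on
    [a]. *)
Lemma amul_monodromy f d a x : x \in zgr (aobj F (E f)) d ->
  amul (zact _ d a) x = amul (ahom F (ind_transl k (commute1 f)) a) x.
Proof.
move=> xd; rewrite /amul -[x in RHS]ahom1E atens_natE -[RHS]ahom_compE.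
rewrite -ind_mul_monodromy !ahom_compE !atens_braidE.
rewrite [zbraid _ (aobj F (E f)) _](tbraidE _ (aobj_trivial a)) zact1 id_lfunE.
by rewrite [zbraid _ _ _](tbraidE _ xd).
Qed.

Lemma dim_aobj V : \dim {:aobj F V} = \dim {:V}.
Proof.
have [u [w [/zhomE uK /zhomE wK]]] := aobj_dual F V.
rewrite (@dim_cancel _ _ _ u w) => [|x|x].
- by rewrite !dimvf; exact: muln1.
- by rewrite -zcompE uK zidE.
- by rewrite -zcompE wK zidE.
Qed.

Lemma dim_ind (f : gT) : \dim {:E f} = #|gT|.
Proof. by rewrite dimvf; exact: muln1. Qed.

End AlgebraImage.

(** * The isomorphism of [F A] with the algebra of functions *)

Section AlgebraIso.
Variables (k : closedFieldType) (gT : finGroupType) (F : dual_autoeq k gT).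
Hypothesis hk : [pchar k] =i pred0.
Implicit Types V U W : zobj k gT.
Local Open Scope lfun_scope.

Notation A := (ind_obj k (1%g : gT)).
Notation E := (ind_obj k).
Notation amul1r := (@amul k gT F 1%g).

Lemma linear_form_at (V : vectType k) (v : V) :
  v != 0 -> exists l : 'Hom(V, k^o), l v = 1.
Proof.
move=> v0; have [/forallP vi|/forallPn[i vi]] :=
  boolP [forall i, coord (vbasis {:V}) i v == 0].
  by case/eqP: v0; rewrite [v]coord_full big1 // => i _;
    rewrite (eqP (vi i)) scale0r.
exists ((coord (vbasis {:V}) i v)^-1 *: lcoord i).
by rewrite scale_lfunE lcoordE; exact: mulVf.
Qed.

Lemma card_group_gt0 : (0 < #|gT|)%N.
Proof. by apply/card_gt0P; exists 1%g. Qed.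

(** The multiplication operators commute, hence share an eigenvector [v]. The eigenvalue of [a] on
    [v], extracted by a form [l] with [l v = 1], is multiplicative in [a]. *)
Lemma exists_algebra_character : exists chi : 'Hom(aobj F A, k^o),
  chi (aone F) = 1 /\ forall a b, chi (amul1r a b) = (chi a : k) * chi b.
Proof.
pose S := aobj F A.
pose L a : 'End(S) := linfun (amul1r a).
have LE a b : L a b = amul a b by rewrite linear_lfunE // => c x y;
  exact: amul_linear_r.
have S0 : {:S}%VS != 0%VS by rewrite -dimv_eq0 dim_aobj dim_ind -lt0n
  card_group_gt0.
have [||v _ [v0 vP]] := @common_eigenvector_in k S [seq L b | b <- vbasis {:S}]
  _ S0.
- by move=> f _; exact: subvf.
- move=> _ _ /mapP[a _ ->] /mapP[b _ ->]; apply/lfunP => x.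
  by rewrite !comp_lfunE !LE -!amulA (amulC a).
pose R : 'End(S) := linfun (fun a => amul1r a v).
have RE a : R a = amul a v by rewrite linear_lfunE // => c x y;
  exact: amul_linear_l.
have Rv a : R a \in <[v]>%VS.
  rewrite [a]coord_full linear_sum rpred_sum // => i _;
    rewrite linearZ rpredZ //= RE.
  have [|c] := vP (L (vbasis {:S})`_i); last by rewrite LE => ->;
    rewrite memvZ ?memv_line.
  by apply: map_f; rewrite mem_nth // size_tuple.
have [l lv] := linear_form_at v0.
have chiE a : amul1r a v = (l (R a) : k) *: v.
  by have /vlineP[c e] := Rv a; rewrite -RE e linearZ /= lv; congr (_ *: _);
    rewrite -[LHS]mulr1.
exists (l \o R); split=> [|a b]; rewrite !comp_lfunE.
  by rewrite RE amul1.
by rewrite RE amulA (chiE b) -LE 2!linearZ /= LE -RE mulrC.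
Qed.

Definition algebra_map (u : 'Hom(aobj F A, A)) : Prop :=
  (forall s, u (aone F) s = 1) /\
  (forall a b s, u (amul1r a b) s = (u a s : k) * u b s).

Lemma aone_act g : zact (aobj F A) g (aone F) = aone F.
Proof. by rewrite -!zhom_act; congr (ahom F _ (aunit F _)); exact: id_lfunE. Qed.

(** Coinduction: the character [chi] extends to the equivariant map sending [a] to the function
    [s |-> chi (s^-1 a)]. *)
Lemma exists_algebra_map : exists u : zhom (aobj F A) A, algebra_map u.
Proof.
have [chi [chi1 chiM]] := exists_algebra_character.
pose u : 'Hom(aobj F A, A) :=
  linfun (fun a => [ffun s : gT => chi (zact (aobj F A) s^-1%g a)] : A).
have uE a s : u a s = chi (zact (aobj F A) s^-1%g a).
  by rewrite linear_lfunE ?ffunE // => c x y; apply/ffunP => t;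
    rewrite !ffunE !linearP.
have uP : u \in @zhom_pred k gT (aobj F A) A.
  apply/zhom_predP; split=> [d a ad|h a].
    have [->|d1] := eqVneq d 1%g; first exact: ind1_trivial.
    have := zpi_hom 1%g ad;
      rewrite (zpi_hom _ (aobj_trivial a)) eqxx eq_sym (negPf d1) => ->.
    by rewrite linear0 mem0v.
  by apply/ffunP => s; rewrite left_translE !uE invMg invgK zactM comp_lfunE.
exists (ZHom uP); split=> [s|a b s]; rewrite !uE; first by rewrite aone_act.
by rewrite amul_act chiM.
Qed.

(* An ideal of the algebra of functions that is invariant under translation is
   trivial: multiplying by indicators, it contains some, hence all of them. *)
Lemma ideal_projection (p : zhom A A) :
  zcomp (zcomp p (ind_mul k 1%g)) (ztensm (zid _) p) =
  zcomp (ind_mul k 1%g) (ztensm (zid _) p) -> p = 0 \/ p = zid A.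
Proof.
move=> pI; have [->|p0] := eqVneq p 0; [by left | right].
have /lfun_neq0[x] : (p : 'Hom(A, A)) != 0.
  by apply: contra p0 => /eqP p0; apply/eqP/zhom_eq.
have [/forallP px|/forallPn[s ps _]] := boolP [forall s, p x s == 0].
  by case/eqP; apply/ffunP => s; rewrite (eqP (px s)) ffunE.
have pds : p (delta k s) = delta k s.
  have /zhomE/(_ (delta k s *t x)) := pI; rewrite !zcompE !ztensmE !zidE.
  have -> : ind_mul k 1%g (delta k s *t p x) = (p x s : k) *: delta k s.
    apply/ffunP => t; rewrite ind_mul_lfunE !ffunE.
    have [->|_] := eqVneq t s; first by rewrite mul1r; exact/esym/mulr1.
    by rewrite mul0r; exact/esym/mulr0.
  rewrite linearZ; exact: scalerI ps _ _.
have pd t : p (delta k t) = delta k t.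
  have -> : delta k t = zact A (t * s^-1)%g (delta k s).
    apply/ffunP => r; rewrite left_translE !ffunE invMg invgK -mulgA.
    by rewrite -{2}[s]mulg1 (inj_eq (mulgI s)) (canF_eq (mulKVg t)) mulg1.
  by rewrite zhom_act pds.
apply: zhom_eq; apply/lfunP => y; rewrite [y]delta_sum !linear_sum.
by apply: eq_bigr => t _; rewrite !linearZ /= pd id_lfunE.
Qed.

(** [p] projects onto the kernel of [u], an ideal. Fullness and faithfulness of [F] turn [p] into an
    endomorphism of [A] with the same ideal property, so it is 0 or the identity. The identity
    contradicts [u 1 = 1]; hence [u] is injective, and the dimensions agree. *)
Lemma algebra_map_iso (u : zhom (aobj F A) A) : algebra_map u ->
  exists w : zhom A (aobj F A), cancel u w /\ cancel w u.
Proof.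
move=> [u1 uM]; have [w uwu] := zhom_regular hk u.
have uwuE x : u (w (u x)) = u x by rewrite -[in RHS]uwu !comp_lfunE.
pose p : zhom _ _ := zid (aobj F A) - (zcomp w u : zhom (aobj F A) (aobj F A)).
have pE x : p x = x - w (u x) by rewrite add_lfunE opp_lfunE zcompE zidE.
have up x : u (p x) = 0 by rewrite pE linearB /= uwuE subrr.
have pI a x : p (amul1r a (p x)) = amul1r a (p x).
  rewrite pE; suff -> : u (amul a (p x)) = 0 by rewrite linear0 subr0.
  by apply/ffunP => s; rewrite uM up !ffunE mulr0.
have [p' p'E] := @ahom_surj _ _ F _ _ p.
have [p'0|p'1] : p' = 0 \/ p' = zid A.
- apply: ideal_projection; apply: (@ahom_inj _ _ F).
  (* Every vector of [F (A (x) A)] comes from [F A (x) F A], where equality can be tested on pure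
     tensors. *)
  have [g gK] := atensV F A A.
  apply: zhom_eq; apply/lfunP => m; rewrite -[m]zidE -gK zcompE; move: (g m) => {}m.
  rewrite -[LHS]comp_lfunE -[RHS]comp_lfunE; congr (fun_of_lfun _ m).
  apply: tens_ext => a x; rewrite !comp_lfunE.
  rewrite !ahom_compE -!atens_natE !ahom1E p'E; exact: pI.
- have uK : cancel u w.
    move=> x; apply/eqP; rewrite eq_sym -subr_eq0 -pE -p'E p'0 ahom0.
    by rewrite zero_lfunE.
  exists w; split=> //; apply: cancel_dim uK.
  by rewrite dim_aobj.
- have := u1 1%g; have := up (aone F).
  rewrite -p'E p'1 ahom1E => -> /eqP; rewrite ffunE eq_sym.
  by rewrite oner_eq0.
Qed.
End AlgebraIso.

(** * The group automorphism induced on right translations *)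

Section InducedAutomorphism.
Variables (k : closedFieldType) (gT : finGroupType) (F : dual_autoeq k gT).
Hypothesis hk : [pchar k] =i pred0.
Implicit Types V U W : zobj k gT.
Local Open Scope lfun_scope.

Notation A := (ind_obj k (1%g : gT)).
Notation E := (ind_obj k).
Notation amul1r := (@amul k gT F 1%g).
Notation delta := (@delta k gT).
Notation shift h := (ind_transl k (commute1 h)).

Lemma delta_sum1 : \sum_s delta s = ind_one k gT (1 : k^o).
Proof.
rewrite [RHS]delta_sum; apply: eq_bigr => s _.
by rewrite ind_one_lfunE scale1r.
Qed.

Lemma ind_mul_delta s t :
  ind_mul k 1%g (delta s *t delta t) = if s == t then delta s else 0.
Proof.
apply/ffunP => r; rewrite ind_mul_lfunE !ffunE.
have [->|st] := eqVneq s t; first by rewrite ffunE; case: eqP;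
  rewrite ?mulr1 ?mulr0.
rewrite ffunE; have [->|_] := eqVneq r s; last exact: mul0r.
by rewrite (negPf st) mulr0.
Qed.

(* Evaluation at 1 after [rho] is a character of the algebra of functions, that
   is, evaluation at some point; equivariance determines [rho]. *)
Lemma algebra_endo_transl (rho : zhom A A) :
  (forall s, rho (ind_one k gT (1 : k^o)) s = 1) ->
  (forall a b s, rho (ind_mul k 1%g (a *t b)) s = (rho a s : k) * rho b s) ->
  exists h, forall a, rho a = right_transl k h a.
Proof.
(* [c] records a character on orthogonal idempotents summing to one, so it is 1 at a single point
   and 0 elsewhere. *)
move=> rho1 rhoM; pose c t : k := rho (delta t) 1%g.
have [t ct] : exists t, c t != 0.
  have [/forallP c0|/forallPn[t ct]] := boolP [forall t, c t == 0];
    last by exists t.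
  have := rho1 1%g; rewrite -delta_sum1 linear_sum sum_ffunE big1 => [|t _].
    by move/eqP; rewrite eq_sym oner_eq0.
  by rewrite /= -[LHS]/(c t) (eqP (c0 t)).
have cM s r : c s * c r = if s == r then c s else 0.
  rewrite /c -rhoM ind_mul_delta; case: eqP => // _.
  by rewrite linear0 ffunE.
have ct1 : c t = 1.
  by apply: (mulfI ct); rewrite cM eqxx mulr1.
have c0 s : s != t -> c s = 0.
  by move=> /negPf st; apply: (mulIf ct); rewrite cM st mul0r.
have ev a : rho a 1%g = a t.
  rewrite [a in LHS]delta_sum linear_sum sum_ffunE (bigD1 t) //= big1 => [|s st].
    by rewrite addr0 linearZ !ffunE -[_ 1%g]/(c t) ct1; exact: mulr1.
  by rewrite linearZ !ffunE -[_ 1%g]/(c s) c0 //; exact: mulr0.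
(* Equivariance gives [rho a s = a (s * t)]; since [right_transl] inverts its parameter, the witness
   is [t^-1]. *)
exists t^-1%g => a; apply/ffunP => s.
have -> : rho a s = zact A s^-1%g (rho a) 1%g by rewrite left_translE invgK mulg1.
by rewrite -zhom_act ev left_translE right_translE !invgK.
Qed.

Section Fixed.
Variables (u : zhom (aobj F A) A) (w : zhom A (aobj F A)).
Hypotheses (uM : algebra_map u) (uK : cancel u w) (wK : cancel w u).

Lemma inverse_one : w (ind_one k gT (1 : k^o)) = aone F.
Proof.
rewrite -[RHS]uK; congr (w _); apply/ffunP => s.
by rewrite uM.1 ind_one_lfunE.
Qed.

Lemma inverse_mul a b : w (ind_mul k 1%g (a *t b)) = amul1r (w a) (w b).
Proof.
rewrite -[RHS]uK; congr (w _); apply/ffunP => s.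
by rewrite uM.2 !wK ind_mul_lfunE.
Qed.

(** Conjugated by [u] and [w], the image of a translation is a unital algebra endomorphism of
    [A]. *)
Lemma exists_shift g :
  exists h, forall a, ahom F (shift g) (w a) = w (right_transl k h a).
Proof.
have [s|a b s|h hP] := algebra_endo_transl (rho := zcomp u (zcomp (ahom F
  (shift g)) w)).
- rewrite !zcompE inverse_one /aone -ahom_compE.
  rewrite -[RHS](uM.1 s); congr (u (ahom F _ _) s).
  apply: zhom_eq; apply/lfunP => c; rewrite comp_lfunE; apply/ffunP => t.
  by rewrite right_translE !ind_one_lfunE.
- by rewrite !zcompE inverse_mul amul_transl uM.2.
by exists h => a; rewrite -hP !zcompE uK.
Qed.

Lemma exists_automorphism : exists phi : {perm gT},
  {morph phi : x y / (x * y)%g} /\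
  forall g a, ahom F (shift g) (w a) = w (right_transl k (phi g) a).
Proof.
have [p pP] := fin_all_exists exists_shift.
have winj := can_inj wK.
have p_inj : injective p.
  move=> g h gh; have e : ahom F (shift g) = ahom F (shift h).
    by apply: zhom_eq; apply/lfunP => a; rewrite -[a]uK !pP gh.
  have /zhomE/(_ (delta 1%g)) := ahom_inj e.
  by rewrite /= !right_transl_delta !mul1g => /delta_inj.
have pM g h : p (g * h)%g = (p g * p h)%g.
  (* Translations reverse products both before and after applying [F], so the reversals cancel and
     [p] is multiplicative. *)
  have e : shift (g * h)%g = zcomp (shift h) (shift g).
    apply: zhom_eq; apply/lfunP => a; apply/ffunP => t.
    by rewrite comp_lfunE !right_translE invMg mulgA.
  have := pP (g * h)%g (delta 1%g).
  rewrite e ahom_compE !pP => /winj.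
  by rewrite !right_transl_delta !mul1g => /delta_inj.
by exists (perm p_inj); split=> [g h|g a]; rewrite !permE.
Qed.
End Fixed.
End InducedAutomorphism.

(** * Homogeneous generators of the images of induced objects *)

Section Generators.
Variables (k : closedFieldType) (gT : finGroupType) (F : dual_autoeq k gT).
Hypothesis hk : [pchar k] =i pred0.
Implicit Types V U W : zobj k gT.
Local Open Scope lfun_scope.

Notation A := (ind_obj k (1%g : gT)).
Notation E := (ind_obj k).
Notation delta := (@delta k gT).
Notation shift h := (ind_transl k (commute1 h)).

Variables (u : zhom (aobj F A) A) (w : zhom A (aobj F A)).
Hypotheses (uM : algebra_map u) (uK : cancel u w) (wK : cancel w u).
Variable phi : {perm gT}.
Hypothesis phiP : forall g a, ahom F (shift g) (w a) = w (right_transl k (phi g) a).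

Section Component.
Variable f : gT.

(** The action of the idempotent of [F A] that corresponds to the indicator of [s]; its image plays
    the role of the fibre of [F E_f] over [s]. *)
Definition component s : 'End(aobj F (E f)) := linfun (@amul k gT F f (w (delta
  s))).

Lemma componentE s x : component s x = amul (w (delta s)) x.
Proof. by rewrite linear_lfunE // => c y z; exact: amul_linear_r. Qed.

Lemma component_act t s x :
  zact _ t (component s x) = component (t * s)%g (zact _ t x).
Proof. by rewrite !componentE amul_act -zhom_act left_transl_delta. Qed.

Lemma component_idem s t x :
  component s (component t x) = if s == t then component s x else 0.
Proof.
rewrite !componentE -amulA -(inverse_mul uM uK wK) ind_mul_delta.
case: eqP => // _; rewrite linear0.
have := amul_linear_l x (-1) 0 0.
by rewrite scaler0 addr0 scaleN1r addNr.
Qed.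

Lemma component_sum x : \sum_s component s x = x.
Proof.
pose L : 'Hom(aobj F A, aobj F (E f)) := linfun (fun a => amul a x).
have LE a : L a = amul a x by rewrite linear_lfunE // => c y z;
  exact: amul_linear_l.
rewrite (eq_bigr (fun s => L (w (delta s)))) => [|s _];
  last by rewrite LE componentE.
rewrite -linear_sum /= -linear_sum /= delta_sum1.
by rewrite LE (inverse_one uM uK) amul1.
Qed.

(** The group permutes the components transitively, so these idempotents have equal traces; they add
    up to [#|gT|], the dimension of [F E_f], and there are [#|gT|] of them. *)
Lemma dim_component : \dim (limg (component 1%g)) = 1%N.
Proof.
have trE s : ltrace (component s) = ltrace (component 1%g).
  have -> : component s = zact _ s \o component 1%g \o zact _ s^-1%g.
    by apply/lfunP => x; rewrite !comp_lfunE component_act mulg1 zactVK.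
  by rewrite ltrace_comp comp_lfunA -zactM mulVg zact1 comp_lfun1l.
have := ltrace1 (aobj F (E f)).
have -> : \1 = \sum_s component s.
  by apply/lfunP => x; rewrite sum_lfunE component_sum id_lfunE.
rewrite linear_sum (eq_bigr _ (fun s _ => trE s)) /= sumr_const dim_aobj dim_ind.
rewrite ltrace_idem => [|]; last first.
  by apply/lfunP => x; rewrite comp_lfunE component_idem eqxx.
rewrite -mulrnA; case: (\dim _) => [|d].
  by move/esym/eqP; rewrite mul0n (natr_neq0 hk) -leqn0 leqNgt card_group_gt0.
rewrite mulSn natrD -[RHS]addr0 => /addrI/eqP; rewrite (natr_neq0 hk) muln_eq0.
by rewrite orbC -leqn0 leqNgt card_group_gt0 /= => /eqP ->.
Qed.

Lemma component_zpi s e x : component s (zpi _ e x) = zpi _ e (component s x).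
Proof.
rewrite -!comp_lfunE; move: x; apply/lfunP/zhom_ext => h v vh.
have cv : component s v \in zgr _ h.
  rewrite componentE -[h]mul1g; apply: zhom_gr.
  by apply: zhom_gr; apply: mem_ztens_gr; [exact: aobj_trivial | exact: vh].
by rewrite !comp_lfunE (zpi_hom _ vh) (zpi_hom _ cv); case: eqP; rewrite ?linear0.
Qed.

(** A nonzero homogeneous vector [b] spans the image of [component 1], and its translates span the
    other components, so a morphism killing [b] is zero. *)
Lemma exists_generator : exists b : aobj F (E f),
  [/\ b \in zgr (aobj F (E f)) (phi f),
      forall V (T : zhom (aobj F (E f)) V), T b = 0 -> T = 0 &
      forall g (gf : commute g f),
        exists c, ahom F (ind_transl k gf) b = c *: zact _ (phi g) b].
Proof.
pose b0 := vpick (limg (component 1%g)).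
have b00 : b0 != 0 by rewrite vpick0 -dimv_eq0 dim_component.
have [e be0] : exists e, zpi _ e b0 != 0.
  have [/forallP z|/forallPn[e]] := boolP [forall e, zpi _ e b0 == 0];
    last by exists e.
  by case/eqP: b00; rewrite -[b0]zpi_sum big1 // => e _; rewrite (eqP (z e)).
pose b := zpi _ e b0.
have b0b : component 1%g b0 = b0.
  by have /memv_imgP[x _ e0] := memv_pick (limg (component 1%g));
    rewrite /b0 e0 component_idem eqxx.
have bb : component 1%g b = b by rewrite component_zpi b0b.
have lineb x : exists c, component 1%g x = c *: b.
  apply/vlineP; have -> : <[b]>%VS = limg (component 1%g).
    by apply/eqP; rewrite eqEdim dim_vline be0 dim_component -memvE -{1}bb
      memv_img ?memvf.
  by rewrite memv_img ?memvf.
have lines s x : exists c, component s x = c *: zact _ s b.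
  have [c cP] := lineb (zact _ s^-1%g x); exists c.
  have -> : component s x = zact _ s (component 1%g (zact _ s^-1%g x)).
    by rewrite component_act mulg1 zactVK.
  by rewrite cP linearZ.
have be : b \in zgr _ e := zpi_mem e b0.
exists b; split=> [|V T Tb|g gf].
- suff <- : e = phi f by [].
  (* Acting by [e] moves the indicator of [e^-1] to that of 1, which fixes [b]; the translation
     moves it to that of [e^-1 * phi f], which kills [b] unless this element is 1. *)
  have := amul_monodromy (w (delta e^-1%g)) be.
  rewrite -zhom_act left_transl_delta mulgV phiP right_transl_delta
    -!componentE bb -{2}bb component_idem.
  case: eqP => [ef _|_ b_eq0]; last by case/eqP: be0.
  by apply: (mulgI e^-1%g); rewrite mulVg.
- apply: zhom_eq; apply/lfunP => x;
  rewrite -[x]component_sum linear_sum zero_lfunE big1 // => s _.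
  by have [c ->] := lines s x; rewrite linearZ /= zhom_act Tb !linear0.
have := lines (phi g) (ahom F (ind_transl k gf) b).
suff -> : component (phi g) (ahom F (ind_transl k gf) b) = ahom F (ind_transl k
  gf) b by [].
by rewrite -{2}bb !componentE amul_transl phiP right_transl_delta mul1g.
Qed.
End Component.
End Generators.

(** * Comparison of characters *)

Section CharacterTransfer.
Variables (k : fieldType) (gT : finGroupType).
Implicit Types V W : zobj k gT.
Local Open Scope lfun_scope.

Lemma sum_dim_zgr V : (\sum_g \dim (zgr V g))%N = \dim {:V}.
Proof. by rewrite -(zgr_full V); apply/esym; have /directvP := zgr_direct V. Qed.

(** [T] restricts to a bijection from [V_f] to [W_f'] intertwining [g] with [c] times [g']; traces
    are invariant under conjugation. *)
Lemma zchar_transfer V W f f' g g' (c : k) (T : 'Hom(V, W)) :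
  commute g f -> (forall v, T (zpi V f v) = T v) ->
  (forall v, T v \in zgr W f') ->
  (forall v, v \in zgr V f -> T v = 0 -> v = 0) ->
  \dim (zgr V f) = \dim (zgr W f') ->
  (forall v, v \in zgr V f -> T (zact V g v) = c *: zact W g' (T v)) ->
  zchar V g f = c * zchar W g' f'.
Proof.
move=> gf Tf Tf' Tinj dimE Tg.
have limT : (T @: zgr V f)%VS = zgr W f'.
  apply/eqP; rewrite eqEdim -dimE limg_dim_eq ?leqnn ?andbT; last first.
    apply/eqP; rewrite -subv0; apply/subvP => v; rewrite memv_cap memv_ker memv0.
    by case/andP=> vf /eqP/(Tinj v vf) ->.
  by apply/subvP => _ /memv_imgP[v _ ->].
(* The pseudo-inverse of [T], cut down to the two components, is the inverse of that bijection. *)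
pose S := zpi V f \o T^-1 \o zpi W f'.
have TS : T \o S = zpi W f'.
  apply/lfunP => v; rewrite !comp_lfunE Tf.
  have := zpi_mem f' v; rewrite -limT => /memv_imgP[x _ ->].
  by rewrite limg_lfunVK ?memv_img ?memvf.
have ST : S \o T = zpi V f.
  apply/lfunP => v; apply/eqP; rewrite -subr_eq0; apply/eqP; apply: Tinj.
    by rewrite rpredB ?zpi_mem // !comp_lfunE zpi_mem.
  by rewrite linearB /= Tf -!comp_lfunE comp_lfunA TS comp_lfunE (zpi_hom _
    (Tf' v)) eqxx subrr.
have TgE : T \o zact V g \o zpi V f = c *: (zact W g' \o T).
  apply/lfunP => v; rewrite !comp_lfunE scale_lfunE comp_lfunE Tg ?zpi_mem //.
  by rewrite Tf.
rewrite /zchar; have <- : zpi V f \o zact V g \o zpi V f = zact V g \o zpi V f.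
  rewrite -comp_lfunA zact_zpi_comp gf mulgK comp_lfunA.
  by rewrite zpi_idem.
clearbody S; rewrite -{1}ST -!comp_lfunA ltrace_comp (comp_lfunA T) TgE.
by rewrite -comp_lfunZl -comp_lfunA TS linearZ.
Qed.
End CharacterTransfer.

Section Comparison.
Variables (k : closedFieldType) (gT : finGroupType) (F : dual_autoeq k gT).
Hypothesis hk : [pchar k] =i pred0.
Local Open Scope lfun_scope.

Notation E := (ind_obj k).

Section Theta.
Variables (f f' : gT) (b : aobj F (E f)).
Hypothesis b_deg : b \in zgr _ f'.
Hypothesis b_gen : forall V (T : zhom (aobj F (E f)) V), T b = 0 -> T = 0.
Variable X : zobj k gT.

(** The chain [X_f = Hom (E_f, X) -> Hom (F E_f, F X) -> F X], the last arrow being evaluation at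
    [b]. *)
Definition theta : 'Hom(X, aobj F X) := linfun (fun x => ahom F (ind_hom f x) b).

Lemma thetaE x : theta x = ahom F (ind_hom f x) b.
Proof.
rewrite linear_lfunE // => c y z.
by rewrite (ind_hom_linear f c) (ahom_linear F c) add_lfunE scale_lfunE.
Qed.

Lemma theta_mem x : theta x \in zgr (aobj F X) f'.
Proof. by rewrite thetaE zhom_gr. Qed.

Lemma theta_zpi x : theta (zpi X f x) = theta x.
Proof.
rewrite !thetaE; congr (ahom F _ b); apply: zhom_eq; apply/lfunP => y.
by rewrite !ind_mapE; apply: eq_bigr => s _; rewrite zpiK eqxx.
Qed.

Lemma theta_inj x : x \in zgr X f -> theta x = 0 -> x = 0.
Proof.
move=> xf; rewrite thetaE => /b_gen; rewrite -(ahom0 F) => /ahom_inj h0.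
have := ind_hom_delta f x; rewrite h0 zero_lfunE (zpi_hom _ xf) eqxx.
by move=> <-.
Qed.

Lemma theta_dim : (\dim (zgr X f) <= \dim (zgr (aobj F X) f'))%N.
Proof.
rewrite -(@limg_dim_eq _ _ _ theta (zgr X f)).
  by apply/dimvS/subvP => _ /memv_imgP[v _ ->]; exact: theta_mem.
apply/eqP; rewrite -subv0; apply/subvP => v; rewrite memv_cap memv_ker memv0.
by case/andP=> vf /eqP/(theta_inj vf) ->.
Qed.

Lemma theta_act g h (c : k) (gf : commute g f) x :
  ahom F (ind_transl k gf) b = c *: zact _ h b ->
  theta (zact X g x) = c *: zact _ h (theta x).
Proof.
by move=> bg; rewrite !thetaE -(ind_hom_transl _ gf) ahom_compE bg linearZ /=
  zhom_act.
Qed.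
End Theta.

(** The factor [c] precedes [X]: it is read off from the action on the generator [b], which depends
    on [f] and [g] alone. *)
Lemma exists_comparison : exists phi : {perm gT},
  {morph phi : x y / (x * y)%g} /\
  forall f g, commute g f -> exists c : k, forall X : zobj k gT,
    zchar X g f = c * zchar (aobj F X) (phi g) (phi f).
Proof.
have [u uM] := exists_algebra_map F.
have [w [uK wK]] := algebra_map_iso hk uM.
have [phi [phiM phiP]] := exists_automorphism uM uK wK.
exists phi; split=> // f g gf.
have gen := exists_generator hk uM uK wK phiP.
have [b [bf bgen bg]] := gen f.
have [c bgc] := bg g gf; exists c => X.
apply: (zchar_transfer gf (T := theta b X)).
- exact: theta_zpi.
- exact: theta_mem.
- exact: theta_inj.
(* Injectivity of [theta] gives an inequality in each degree. As [phi] permutes the degrees and the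
   total dimensions agree, all of these are equalities. *)
- have le h : (\dim (zgr X h) <= \dim (zgr (aobj F X) (phi h)) ?= iff
                (\dim (zgr X h) == \dim (zgr (aobj F X) (phi h))))%N.
    by split=> //; have [b' [b'f b'gen _]] := gen h; exact: (theta_dim b'f b'gen X).
  have [_] := leqif_sum (fun h (_ : xpredT h) => le h).
  have -> : (\sum_h \dim (zgr (aobj F X) (phi h)))%N = \dim {:aobj F X}.
    by rewrite -sum_dim_zgr [RHS](reindex_inj (@perm_inj _ phi)).
  by rewrite sum_dim_zgr dim_aobj eqxx => /esym/forallP/(_ f)/eqP.
by move=> x _; exact: theta_act bgc.
Qed.
End Comparison.

(** * Characters separate conjugacy classes of commuting pairs *)

Section KernelObject.
Variables (k : fieldType) (gT : finGroupType) (V : zobj k gT) (y : zhom V V).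
Local Open Scope lfun_scope.

Notation M := (subvs_of (lker y)).

Definition restrict (T : 'End(V)) : 'End(M) :=
  linfun (fun x : M => vsproj (lker y) (T (vsval x))).

Lemma restrictE (T : 'End(V)) : T \o y = y \o T ->
  forall x : M, vsval (restrict T x) = T (vsval x).
Proof.
move=> Ty x; rewrite linear_lfunE => [|c a b]; last by rewrite !linearP.
rewrite vsprojK // memv_ker -comp_lfunE -Ty comp_lfunE.
by have := subvsP x; rewrite memv_ker => /eqP ->; rewrite linear0.
Qed.

Definition res_zpi d := restrict (zpi V d).
Definition res_zact h := restrict (zact V h).

Lemma res_zpiE d (x : M) : vsval (res_zpi d x) = zpi V d (vsval x).
Proof. by apply: restrictE; rewrite zhom_zpi_comp. Qed.

Lemma res_zactE h (x : M) : vsval (res_zact h x) = zact V h (vsval x).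
Proof. by apply: restrictE; rewrite zhom_act_comp. Qed.

Definition ker_gr d : {vspace M} := limg (res_zpi d).

Lemma res_zpi_hom g h (x : M) : x \in ker_gr h -> res_zpi g x = if g == h then
  x else 0.
Proof.
case/memv_imgP=> z _ ->; apply: val_inj => /=; rewrite !res_zpiE zpiK.
by case: eqP => // _; rewrite res_zpiE.
Qed.

Fact ker_full : (\sum_d ker_gr d)%VS = fullv.
Proof.
apply: full_of_mem => x; have -> : x = \sum_d res_zpi d x.
  apply: val_inj; rewrite /= linear_sum -[LHS](zpi_sum (vsval x)).
  by apply: eq_bigr => d _; rewrite /= res_zpiE.
rewrite rpred_sum // => d _.
by apply: (subvP (sumv_sup d _ (subvv _))) => //; rewrite memv_img ?memvf.
Qed.

Fact ker_direct : direct_family ker_gr.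
Proof. exact: direct_of_pi res_zpi_hom. Qed.

Fact res_zact1 : res_zact 1%g = \1.
Proof. by apply/lfunP => x; apply: val_inj;
  rewrite /= res_zactE zact1 !id_lfunE. Qed.

Fact res_zactM g h : res_zact (g * h)%g = res_zact g \o res_zact h.
Proof.
by apply/lfunP => x; apply: val_inj;
  rewrite comp_lfunE /= !res_zactE zactM comp_lfunE.
Qed.

Fact res_zact_gr h d : (res_zact h @: ker_gr d <= ker_gr (h * d * h^-1)%g)%VS.
Proof.
apply/subvP => _ /memv_imgP[_ /memv_imgP[x _ ->] ->].
have -> : res_zact h (res_zpi d x) = res_zpi (h * d * h^-1)%g (res_zact h x).
  apply: val_inj; rewrite /= res_zactE !res_zpiE res_zactE.
  by rewrite -!comp_lfunE zact_zpi_comp.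
by rewrite memv_img ?memvf.
Qed.

(** Eigenspaces of endomorphisms thereby become objects of the centre, to which a character identity
    valid for all objects applies. *)
Definition ker_obj : zobj k gT :=
  ZObj ker_full ker_direct res_zact1 res_zactM
    (act_gr_of_sub res_zact1 res_zactM res_zact_gr).

Lemma ker_incl_subproof : linfun vsval \in @zhom_pred k gT ker_obj V.
Proof.
apply/zhom_predP; split=> [d _ /memv_imgP[x _ ->]|h x]; rewrite !lfunE /=.
  by rewrite res_zpiE zpi_mem.
by rewrite res_zactE.
Qed.

Definition ker_incl : zhom ker_obj V := ZHom ker_incl_subproof.

Lemma ker_inclE (x : M) : ker_incl x = vsval x.
Proof. by rewrite lfunE. Qed.
End KernelObject.

Section CentralElements.
Variables (k : fieldType) (gT : finGroupType).
Implicit Types V W : zobj k gT.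
Local Open Scope lfun_scope.

(* The action of the class sum of the commuting pair [(f, g)] in the centre of
   the Drinfeld double. *)
Definition class_sum g f V : 'End(V) :=
  \sum_t (zact V (t * g * t^-1)%g \o zpi V (t * f * t^-1)%g).

Lemma class_sumE g f V v :
  class_sum g f V v = \sum_t zact V (t * g * t^-1)%g (zpi V (t * f * t^-1)%g v).
Proof. by rewrite sum_lfunE; apply: eq_bigr => t _; rewrite comp_lfunE. Qed.

Lemma ltrace_class_sum g f V : ltrace (class_sum g f V) = #|gT|%:R * zchar V g f.
Proof.
rewrite linear_sum (eq_bigr (fun=> zchar V g f)) => [|t _]; last exact: zchar_conj.
by rewrite sumr_const mulr_natl.
Qed.

Lemma class_sum_nat g f V W (u : zhom V W) :
  u \o class_sum g f V = class_sum g f W \o u.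
Proof.
apply/lfunP => v; rewrite !comp_lfunE !class_sumE linear_sum.
by apply: eq_bigr => t _; rewrite /= zhom_act zhom_zpi.
Qed.

Lemma commute_conj (t g f : gT) :
  commute g f -> commute (t * g * t^-1)%g (t * f * t^-1)%g.
Proof. by move=> gf; rewrite /commute !mulgA !mulgKV -!(mulgA t) gf. Qed.

Lemma class_sum_subproof g f V : commute g f -> class_sum g f V \in @zhom_pred
  k gT V V.
Proof.
move=> gf; apply/zhom_predP; split=> [d v vd|h v]; rewrite !class_sumE.
  apply: rpred_sum => t _; rewrite (zpi_hom _ vd).
  case: eqP vd => [<- vd|_ _]; last by rewrite linear0 mem0v.
  by have := zact_mem (t * g * t^-1)%g vd; rewrite (commute_conj t gf) mulgK.
rewrite linear_sum (reindex_inj (mulgI h)) /=; apply: eq_bigr => t _.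
have := congr1 (fun T : 'End(V) => T v) (zact_zpi_comp V h (t * f * t^-1)%g).
rewrite !comp_lfunE !invMg !mulgA => <-.
by rewrite -!comp_lfunE -!zactM mulgKV !mulgA.
Qed.

Section Separation.
Variables (g f g' f' : gT) (c : k).
Hypotheses (gf : commute g f) (gf' : commute g' f').

(** This endomorphism is natural in [V], and its trace measures the failure of the character
    identity on [V]. *)
Definition class_sum_hom V : zhom V V := ZHom (class_sum_subproof V gf) -
   c *: (ZHom (class_sum_subproof V gf') : zhom V V).

Lemma class_sum_homE V : class_sum_hom V = class_sum g f V - c *: class_sum g'
  f' V :> 'End(V).
Proof. by []. Qed.

Lemma class_sum_hom_nat V W (u : zhom V W) :
  u \o class_sum_hom V = class_sum_hom W \o u.
Proof.
rewrite !class_sum_homE comp_lfunDl comp_lfunDr comp_lfunNl comp_lfunNr.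
by rewrite -comp_lfunZl -comp_lfunZr !class_sum_nat.
Qed.

Lemma class_sum_hom_natE V W (u : zhom V W) x :
  u (class_sum_hom V x) = class_sum_hom W (u x).
Proof. by rewrite -!comp_lfunE class_sum_hom_nat. Qed.

Lemma ltrace_class_sum_hom V :
  ltrace (class_sum_hom V) = #|gT|%:R * (zchar V g f - c * zchar V g' f').
Proof.
by rewrite class_sum_homE linearB linearZ /= !ltrace_class_sum mulrBr (mulrCA c).
Qed.

(** Each term of the class sum, composed with the translation, sends an indicator to an indicator or
    to 0. The trace thus counts the pairs [s], [t] for which the term of [t] fixes the indicator of
    [s]. *)
Lemma ltrace_class_sum_ind g0 f0 :
  let B s t := ((t * g0 * t^-1)^-1 * s == s * g^-1)%g &&
    ((t * g0 * t^-1)^-1 * s * f * ((t * g0 * t^-1)^-1 * s)^-1 == t * f0 * t^-1)%g in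
  ltrace (class_sum g0 f0 (ind_obj k f) \o right_transl k g^-1%g) =
  (\sum_s \sum_t B s t)%:R.
Proof.
move=> B; pose ev (s : gT) : 'Hom(ind_obj k f, k^o) :=
  linfun (fun x : {ffun gT -> k^o} => x s).
have evE s (x : {ffun gT -> k^o}) : ev s x = x s.
  by rewrite linear_lfunE // => a y z; rewrite !ffunE.
rewrite (@ltrace_dual_family k _ (ind_obj k f) (@delta k gT) ev) => [|x];
  last first.
  by rewrite [LHS]delta_sum; apply: eq_bigr => s _; rewrite evE.
rewrite natr_sum; apply: eq_bigr => s _; rewrite natr_sum evE comp_lfunE class_sumE.
rewrite sum_ffunE; apply: eq_bigr => t _.
rewrite left_translE zpi_ind supp_projE right_transl_delta ffunE /B.
by case: eqP => _; rewrite ?andbT ?andbF.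
Qed.
End Separation.
End CentralElements.

Section Separation.
Variables (k : closedFieldType) (gT : finGroupType).
Variables (g f g' f' : gT) (c : k).
Hypotheses (gf : commute g f) (gf' : commute g' f').
Hypothesis hk : [pchar k] =i pred0.
Local Open Scope lfun_scope.

Lemma ltrace_scale (V : vectType k) (T : 'End(V)) (a : k) (v : V) :
  v != 0 -> (forall x, T x = a *: x) -> ltrace T = 0 -> a = 0.
Proof.
move=> v0 Ta; have -> : T = a *: \1.
  by apply/lfunP => x; rewrite scale_lfunE id_lfunE.
rewrite linearZ /= ltrace1 => /eqP;
  rewrite mulf_eq0 (natr_neq0 hk) => /orP[/eqP//|].
rewrite dimv_eq0 => /eqP V0; case/eqP: v0; apply/eqP.
by rewrite -memv0 -V0 memvf.
Qed.

(** By naturality the endomorphism is the scalar [l] on its eigenspace, a nonzero object of the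
    centre, where its trace vanishes by [charE]. *)
Lemma class_sum_eigenvalue (V : zobj k gT) l (x : V) :
  (forall X : zobj k gT, zchar X g f = c * zchar X g' f') ->
  x != 0 -> class_sum_hom c gf gf' V x = l *: x -> l = 0.
Proof.
move=> charE x0 yx.
pose yl : zhom V V := class_sum_hom c gf gf' V - l *: (zid V : zhom V V).
have ylE z : yl z = class_sum_hom c gf gf' V z - l *: z.
  by rewrite add_lfunE opp_lfunE scale_lfunE id_lfunE.
clearbody yl; pose M := ker_obj yl.
have xM : x \in lker yl by rewrite memv_ker ylE yx subrr.
apply: (@ltrace_scale M (class_sum_hom c gf gf' M) l (Subvs xM)).
- by apply: contra x0 => /eqP/(congr1 vsval)/= ->.
- move=> z; apply: val_inj; rewrite [RHS]linearZ /=.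
  have := subvsP z; rewrite memv_ker ylE subr_eq0 => /eqP <-.
  by rewrite -(ker_inclE z) -class_sum_hom_natE ker_inclE.
by rewrite ltrace_class_sum_hom charE subrr mulr0.
Qed.

(** For non-conjugate pairs, the class sum of the second pair contributes 0 to the trace of [y \o r]
    on [E_f], while that of the first contributes a positive count. So [y] has a nonzero eigenvalue,
    against [class_sum_eigenvalue]. *)
Lemma zchar_separates :
  (forall X : zobj k gT, zchar X g f = c * zchar X g' f') ->
  exists t, f' = (t * f * t^-1)%g /\ g' = (t * g * t^-1)%g.
Proof.
move=> charE.
have [/existsP[t /andP[/eqP -> /eqP ->]]|nconj] :=
  boolP [exists t, (f' == t * f * t^-1)%g && (g' == t * g * t^-1)%g];
    first by exists t.
exfalso; pose V := ind_obj k f; pose y := class_sum_hom c gf gf' V.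
(* Right translation by [g^-1] undoes the action of [g] on the indicator of 1, which makes the pair
   [s = t = 1] count. *)
have gVf : commute g^-1%g f by apply/commute_sym/commuteV/commute_sym.
pose r := ind_transl k gVf.
have tr0 : ltrace (y \o r) != 0.
  rewrite class_sum_homE comp_lfunDl comp_lfunNl -comp_lfunZl linearB linearZ /=.
  rewrite !ltrace_class_sum_ind.
  have -> : (\sum_s \sum_t ((t * g' * t^-1)^-1 * s == s * g^-1)%g &&
    ((t * g' * t^-1)^-1 * s * f * ((t * g' * t^-1)^-1 * s)^-1 == t * f' * t^-1)%g
    = 0)%N.
    apply: big1 => s _; apply: big1 => t _; apply/eqP; rewrite eqb0.
    apply: contra nconj => /andP[/eqP e1 /eqP]; rewrite e1 => e2.
    (* The two conditions say that [t] conjugates [g'], [f'] to what [s] conjugates [g], [f] to. *)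
    apply/existsP; exists (t^-1 * s)%g; apply/andP; split; apply/eqP.
      apply: (mulgI t); apply: (mulIg t^-1%g); rewrite -e2 !invMg !invgK !mulgA.
      by rewrite mulgV mul1g mulgK -(mulgA s) gVf mulgA mulgKV.
    apply: (mulgI t); apply: (mulIg t^-1%g); apply: invg_inj; apply: (mulIg s).
    by rewrite e1 !invMg !invgK !mulgA mulgV mul1g mulgK mulgKV.
  rewrite mulr0 subr0 (natr_neq0 hk) (bigD1 1%g) //= (bigD1 1%g) //=.
  rewrite !mul1g invg1 !mulg1 eqxx /= invgK gVf mulgKV eqxx.
  by [].
have ry : r \o y = y \o r by exact: class_sum_hom_nat.
have [l l0 [x x0 yx]] := ltrace_comp_eigenvector ry tr0.
by move/eqP: l0; apply; exact: class_sum_eigenvalue charE x0 yx.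
Qed.
End Separation.

(** * Dualising autoequivalences and double class inversion *)

Lemma zchar_iso (k : fieldType) (gT : finGroupType) (V W : zobj k gT)
    (u : zhom V W) (w : zhom W V) g f :
  zcomp w u = zid V -> zcomp u w = zid W -> zchar V g f = zchar W g f.
Proof.
move=> /(congr1 (@zhom_val _ _ _ _))/= wu /(congr1 (@zhom_val _ _ _ _))/= uw.
rewrite /zchar -[zact V g]comp_lfun1l -wu -!comp_lfunA ltrace_comp.
rewrite (comp_lfunA u) zhom_act_comp -(comp_lfunA _ u) zhom_zpi_comp.
by rewrite -!comp_lfunA uw comp_lfun1r.
Qed.

Theorem theorem2p9 (k : closedFieldType) (hk : [pchar k]%R =i pred0)
    (gT : finGroupType) :
  (exists F : braidedFunctor (drinfeld_centre k gT) (drinfeld_centre k gT),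
     is_equivalence F /\ dualising F) <->
  (exists phi : {perm gT},
     phi \in Aut [set: gT] /\ double_class_inverting phi).
Proof.
split=> [[F [Fequiv Fdual]]|[phi [phiA dci]]].
  pose F' := unfold_functor Fequiv Fdual.
  have [phi [phiM charF]] := exists_comparison F' hk.
  exists phi; split=> [|f g fg].
    rewrite inE; apply/andP; split; first by apply/subsetP => x _; rewrite inE.
    by apply/morphicP => x y _ _; exact: phiM.
  have [c charE] := charF _ _ (commute_sym fg).
  have commV : commute (phi g)^-1%g (phi f)^-1%g.
    by apply/commuteV/commute_sym/commuteV; rewrite /commute -!phiM fg.
  (* As [F X] is isomorphic to the dual of [X], its character at [phi g], [phi f] is that of [X] at
     the inverses. *)
  have [X|t [ef eg]] := zchar_separates (c := c) (commute_sym fg) commV hk.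
    have [u [w [wu uw]]] := aobj_dual F' X.
    by rewrite charE (zchar_iso _ _ wu uw) zchar_dual.
  exists t; rewrite -[phi f]invgK -[phi g]invgK ef eg.
  by rewrite !invMg !invgK !mulgA.
have phiM : {morph phi : x y / (x * y)%g}.
  by move: phiA; rewrite inE => /andP[_ /morphicP phiM] x y; apply: phiM;
    rewrite inE.
(* Twisting goes along [phi^-1], so that degree [phi f] of the twisted object is degree [f] of the
   original one. *)
have psiM : {morph (phi^-1)%g : x y / (x * y)%g}.
  by move=> x y; apply: (@perm_inj _ phi); rewrite phiM !permKV.
exists (twist_braided k psiM); split.
  exact: (twist_equivalence k psiM phiM (permKV phi) (permK phi)).
exact: twist_dualising hk (permKV phi) dci.
Qed.
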